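(* Let $F$ and $G$ be non-constant entire functions. Let $0<R<\infty$ and let $L$ be a holomorphic function on $D(0,R)$ which solves $$L'(z)=e^{F(z)}e^{-G(L(z))},\qquad L(0)=0,$$ and such that for every $\epsilon>0$, $L$ does not extend to a holomorphic function on $D(0,R+\epsilon)$. Let $f(z)=\int_{0}^{z}e^{F(t)}\,dt$ and $g(w)=\int_{0}^{w}e^{G(t)}\,dt$. Then: (1) There is no sequence $\{z_n\}_{n\ge1}\subseteq D(0,R)$ with $\lim z_n=\alpha\in\overline{D}(0,R)$ such that $\{L(z_n)\}_{n\geq1}$ is bounded but $\lim L(z_n)$ does not exist. Moreover there is a subset $A_\infty\subseteq\partial D(0,R)$ such that: (2) For every $\alpha\in\partial D(0,R)\setminus A_\infty$ the limit $\lim_{z\to\alpha,\,z\in D(0,R)}L(z)$ exists and is a (finite) complex number. (3) For every $\alpha\in\partial D(0,R)\setminus A_\infty$ there is an $\epsilon_\alpha>0$ such that $L$ has an analytic continuation to the disk $D(\alpha,\epsilon_\alpha)$. (4) (a) $A_\infty\neq\emptyset$. (b) For every $\alpha\in A_\infty$, $\lim_{z\to\alpha,\,z\in D(0,R)}|L(z)|=\infty$ and $\lim_{z\to\alpha,\,z\in D(0,R)}g(L(z))=f(\alpha)$. (c) $f(A_\infty)\subseteq A_g$. (d) $A_\infty$ is a closed subset of $\partial D(0,R)$. (e) The one-dimensional Lebesgue (arc length) measure of $A_\infty$ is $0$.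
   Context: $D(c,r)=\{z\in\mathbb{C}:|z-c|<r\}$ and $\overline{D}(c,r)$ is its closure. For an entire function $g$, $A_g$ denotes the set of all finite asymptotic values of $g$, i.e. of all $\alpha\in\mathbb{C}$ for which there is a continuous curve $\gamma:[0,\infty)\to\mathbb{C}$ with $\lim_{t\to\infty}|\gamma(t)|=\infty$ and $\lim_{t\to\infty}g(\gamma(t))=\alpha$. *)

(* Defs.v *)
From HB Require Import structures.
From mathcomp Require Import all_boot all_order all_algebra complex.
From mathcomp Require Import all_classical all_reals all_analysis.

Set Implicit Arguments.
Unset Strict Implicit.
Unset Printing Implicit Defensive.
Import Order.TTheory GRing.Theory Num.Theory.
Import numFieldNormedType.Exports.

Local Open Scope classical_set_scope.
Local Open Scope complex_scope.
Local Open Scope ring_scope.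

(* R[i] carries the topology of its modulus and is a normed space over itself,
   so that [derivable f z 1] and [derive1 f z], for f : R[i] -> R[i], are
   complex differentiability and the complex derivative. *)
HB.instance Definition _ (R : realType) := PseudoPointedMetric.copy R[i] R[i]^o.
#[non_forgetful_inheritance]
HB.instance Definition _ (R : realType) := GRing.ComAlgebra.copy R[i] R[i]^o.
HB.instance Definition _ (R : realType) := Vector.copy R[i] R[i]^o.
HB.instance Definition _ (R : realType) := NormedModule.copy R[i] R[i]^o.

Section complex_analysis.
Variable R : realType.
Implicit Types (U A : set R[i]) (f h : R[i] -> R[i]) (c z : R[i]) (r : R).

(* The modulus of R[i], hence the radius of its balls, is valued in R[i]. *)
Definition disk c r : set R[i] := ball c r%:C.

Definition closed_disk c r : set R[i] := closure (disk c r).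

Definition circle c r : set R[i] := [set z | `|z - c| = r%:C].

Definition cexp z : R[i] :=
  (expR (complex.Re z))%:C * (cos (complex.Im z) +i* sin (complex.Im z)).

(* Meant for open U; the values of f outside U are irrelevant. *)
Definition holomorphic_on U f : Prop := forall z, U z -> derivable f z 1.

Definition entire f : Prop := holomorphic_on setT f.

Definition nonconstant f : Prop := ~ exists c, forall z, f z = c.

(* f, given on U, agrees on U `&` V with a holomorphic function on V. *)
Definition continues_to U f V : Prop :=
  exists2 h, holomorphic_on V h & forall z, U z -> V z -> h z = f z.

Definition cintegral (D : set R) (u : R -> R[i]) : R[i] :=
  (\int[lebesgue_measure]_(t in D) complex.Re (u t))%R +i*
  (\int[lebesgue_measure]_(t in D) complex.Im (u t))%R.

(* The integral of h along the segment t |-> t z, t in [0, 1]. *)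
Definition primitive0 h z : R[i] :=
  cintegral `[0, 1] (fun t => h (t%:C * z) * z).

Definition asymptotic_values f : set R[i] :=
  [set a | exists gamma : R -> R[i],
    [/\ {within `[0, +oo[, continuous gamma},
        `|gamma t| @[t --> +oo] --> +oo
      & f (gamma t) @[t --> +oo] --> a]].

(* Arc length on the circle of centre 0 and radius r, whose parametrization
   t |-> r e^(it) by [0, 2 pi[ has constant speed r. *)
Definition arc_length r A : \bar R :=
  (r%:E * lebesgue_measure
    (`[0%R, (2 * pi)%R[ `&` [set t : R | A (r%:C * cexp (t *i))%R]))%E.

End complex_analysis.

(* Main.v *)
(* Integrating the differential equation gives g (L z) = f z on the disk, with
   f' = e^F and g' = e^G, so that g is locally injective everywhere. If L takes
   values near w arbitrarily close to a boundary point a, then g w = f a, and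
   since g <> f a on small circles around w, L maps a whole convex neighbourhood
   of a in the disk into a small disk around w. Hence at each boundary point L
   either blows up or has a finite limit w; in the second case a local inverse
   of g near w, composed with f, continues L. If there were no blow-up, these
   continuations, glued along radii by uniqueness of lifts, would extend L to a
   larger disk. The image of a radius ending at a blow-up point a is an
   asymptotic curve of g with value f a.

   For the measure, put z = r e^(i zeta). Near a blow-up point log L is
   holomorphic on a rectangle 0 < Im zeta <= b, with real part U = log |L| > 0.
   Cauchy's theorem applied to log L times a cosine vanishing on the vertical
   sides bounds the integral of U against a positive weight on the horizontal
   line Im zeta = tau, uniformly as tau -> 0, while U tends to infinity on the
   blow-up set, which must therefore be null. *)

Require Import Defs.
From HB Require Import structures.
From mathcomp Require Import all_boot all_order all_algebra complex.
From mathcomp Require Import all_classical all_reals all_analysis.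
From mathcomp Require Import measurable_realfun ring lra.

Set Implicit Arguments.
Unset Strict Implicit.
Unset Printing Implicit Defensive.
Import Order.TTheory GRing.Theory Num.Theory.
Import numFieldNormedType.Exports.

Local Open Scope classical_set_scope.
Local Open Scope complex_scope.
Local Open Scope ring_scope.

Local Notation Re := complex.Re.
Local Notation Im := complex.Im.


(** * Moduli, compactness and completeness *)

(** Everything rests on first-order complex differentiability. That [L'] is differentiable is read
    off the equation, which writes it through [F], [G] and [L]; that [g] can be inverted locally
    comes from the mean value inequality and the continuity of [g' = e^G]. Derivatives are taken
    along arbitrary sets, so that segments, closed rectangles and the plane are treated alike, and a
    line integral is the increment of a primitive. Compactness and connectedness enter mostly
    through Cousin's lemma.

    The obstacle in the measure estimate is that [log L] is not controlled on the vertical sides of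
    the rectangle, which may end at blow-up points. The weight [cos (k (zeta - t0 - i tau))] with
    [k = pi / (2 a)] is purely imaginary on these sides, with opposite signs on the two. Hence only
    [U > 0] enters there, and both sides contribute with a sign that allows them to be dropped. What
    remains is the top side, which keeps a fixed distance from the circle. *)

Section Cousin.
Variable R : realType.

(** Real induction: the supremum of the [s] with [P a s] can always be passed, up to [b]. Depending
    on [P] this serves as compactness, as connectedness, or as a way to add up local estimates. *)
Lemma cousin (a b : R) (P : R -> R -> Prop) : a <= b ->
  (forall x y z, x <= y -> y <= z -> P x y -> P y z -> P x z) ->
  (forall t, a <= t <= b -> exists2 d, 0 < d &
     forall x y, a <= x -> y <= b -> t - d < x -> x <= t -> t <= y ->
       y < t + d -> P x y) ->
  P a b.
Proof.
move=> ab Ptr Ploc; pose S := [set s | a <= s <= b /\ P a s].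
have Sa : S a.
  split; first by rewrite lexx.
  have [|d d0 Pd] := Ploc a; first by rewrite lexx.
  by apply: Pd => //; lra.
have Sub : has_sup S.
  by split; [exists a | exists b => s [/andP[_ ?] _]].
set c := sup S.
have Sc s : S s -> s <= c by apply: ub_le_sup; case: Sub.
have ac : a <= c by exact: Sc.
have cb : c <= b by apply: ge_sup; [exists a|move=> s [/andP[_ ?] _]].
have [|d d0 Pd] := Ploc c; first by rewrite ac cb.
have [s [/andP[sa sb] Ps] sc] := sup_adherent d0 Sub.
have sc' : s <= c by apply: Sc; rewrite /S /= sa.
(* [y] lies beyond the supremum [c] unless [c = b], and [P a y] forbids the former. *)
pose y := Num.min b (c + d / 2).
have yb : y <= b by rewrite ge_min lexx.
have cy : c <= y by rewrite le_min cb /=; lra.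
have yd : y < c + d by rewrite gt_min; apply/orP; right; lra.
have Py : P a y by apply: (Ptr _ s) => //; [lra|apply: Pd].
have yc : y <= c by apply: Sc; split=> //; rewrite yb; lra.
suff -> : b = y by [].
by move: yc cy; rewrite /y minElt; case: ifPn => // _ h1 h2; lra.
Qed.

Lemma locally_constant_itv (a b : R) (Q : R -> Prop) : a <= b ->
  (forall t, a <= t <= b -> exists2 d, 0 < d &
     forall s, a <= s <= b -> `|s - t| < d -> (Q s <-> Q t)) ->
  Q a <-> Q b.
Proof.
move=> ab Qloc; apply: (@cousin a b (fun x y => Q x <-> Q y)) => //.
  by move=> x y z _ _ [? ?] [? ?]; split; auto.
move=> t tab; have [d d0 Qd] := Qloc t tab; exists d => // x y ax yb tx xt ty yt.
have /andP[ta tb] := tab.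
have [h1 h2] : Q x <-> Q t by apply: Qd; [lra|rewrite ltr_norml; lra].
have [h3 h4] : Q y <-> Q t by apply: Qd; [lra|rewrite ltr_norml; lra].
by split; auto.
Qed.

End Cousin.

(** The norm of [R[i]] is valued in [R[i]]; this copy is valued in [R], where [lra] and [nra]
    apply. *)
Definition cmod (R : realType) (z : R[i]) : R := Normc.normc z.

Section Modulus.
Variable R : realType.
Implicit Types z w l : R[i].

Lemma cmodE z : `|z| = (cmod z)%:C. Proof. by []. Qed.

Lemma cmod_sqrt z : cmod z = Num.sqrt (Re z ^+ 2 + Im z ^+ 2).
Proof. by case: z. Qed.

Lemma cmod_ge0 z : 0 <= cmod z.
Proof. by rewrite cmod_sqrt sqrtr_ge0. Qed.

Lemma cmod0 : cmod (0 : R[i]) = 0. Proof. exact: Normc.normc0. Qed.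

Lemma cmodM z w : cmod (z * w) = cmod z * cmod w.
Proof. exact: Normc.normcM. Qed.

Lemma cmodV z : cmod z^-1 = (cmod z)^-1.
Proof. exact: Normc.normcV. Qed.

Lemma cmodD z w : cmod (z + w) <= cmod z + cmod w.
Proof. exact: le_normcD. Qed.

Lemma cmodN z : cmod (- z) = cmod z. Proof. exact: normcN. Qed.

Lemma cmodB z w : cmod (z - w) = cmod (w - z).
Proof. by rewrite -cmodN opprB. Qed.

Lemma cmod_tri z w l : cmod (z - l) <= cmod (z - w) + cmod (w - l).
Proof. by apply: le_trans (cmodD _ _); rewrite addrA subrK. Qed.

Lemma cmod_real (x : R) : cmod x%:C = `|x|.
Proof. by rewrite cmod_sqrt /= expr0n addr0 sqrtr_sqr. Qed.

Lemma cmod_Re z : `|Re z| <= cmod z.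
Proof. by rewrite cmod_sqrt -sqrtr_sqr ler_wsqrtr // lerDl sqr_ge0. Qed.

Lemma cmod_Im z : `|Im z| <= cmod z.
Proof. by rewrite cmod_sqrt -sqrtr_sqr ler_wsqrtr // lerDr sqr_ge0. Qed.

Lemma cmodi : cmod ('i : R[i]) = 1.
Proof. by rewrite cmod_sqrt /= expr0n expr1n add0r sqrtr1. Qed.

Lemma cmod_leD z : cmod z <= `|Re z| + `|Im z|.
Proof.
rewrite [z in cmod z]complexE; apply: le_trans (cmodD _ _) _.
by rewrite cmodM !cmod_real cmodi mul1r.
Qed.

Lemma cmod_eq0 z : (cmod z == 0) = (z == 0).
Proof. by apply/eqP/eqP => [/Normc.eq0_normc //|->]; exact: cmod0. Qed.

Lemma cmod_gt0 z : (0 < cmod z) = (z != 0).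
Proof. by rewrite lt_def cmod_ge0 andbT cmod_eq0. Qed.

Lemma ReD z w : Re (z + w) = Re z + Re w. Proof. by case: z; case: w. Qed.
Lemma ReB z w : Re (z - w) = Re z - Re w. Proof. by case: z; case: w. Qed.
Lemma ImD z w : Im (z + w) = Im z + Im w. Proof. by case: z; case: w. Qed.
Lemma ImB z w : Im (z - w) = Im z - Im w. Proof. by case: z; case: w. Qed.

Lemma complex_eqP z w : Re z = Re w -> Im z = Im w -> z = w.
Proof. by case: z => ? ?; case: w => ? ? /= -> ->. Qed.

Lemma disk0P z (r : R) : disk 0 r z <-> cmod z < r.
Proof. by rewrite /disk -ball_normE /= sub0r normrN cmodE ltcR. Qed.

Lemma diskP c z (r : R) : disk c r z <-> cmod (z - c) < r.
Proof. by rewrite /disk -ball_normE /= cmodE ltcR cmodB. Qed.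

Lemma near_nbhsC z (P : R[i] -> Prop) :
  (\forall w \near nbhs z, P w) <->
  exists2 d : R, 0 < d & forall w, cmod (w - z) < d -> P w.
Proof.
split.
  (* A positive element of [R[i]] is real, so the radius reduces to its real part [e]. *)
  case/nbhs_ballP => -[e e'] /=; rewrite ltcE /= => /andP[/eqP -> e0] eP.
  by exists e => // w wz; apply: eP; rewrite -ball_normE /= cmodE ltcR cmodB.
case=> d d0 dP; apply/nbhs_ballP; exists d%:C; first by rewrite /= ltcR.
by move=> w; rewrite -ball_normE /= cmodE ltcR cmodB => /dP.
Qed.

Lemma near_withinC (D : set R[i]) z (P : R[i] -> Prop) :
  (\forall w \near within D (nbhs z), P w) <->
  exists2 d : R, 0 < d & forall w, D w -> cmod (w - z) < d -> P w.
Proof.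
rewrite near_withinE; rewrite near_nbhsC.
by split=> -[d d0 dP]; exists d => // w; auto.
Qed.

Lemma cvgCP T (F : set_system T) (FF : Filter F) (f : T -> R[i]) l :
  (f x @[x --> F] --> l) <->
  forall e : R, 0 < e -> \forall x \near F, cmod (f x - l) < e.
Proof.
split=> [fl e e0|h].
  by apply: (fl (fun y => cmod (y - l) < e)); apply/near_nbhsC; exists e.
by move=> A /near_nbhsC [d /h + dA]; rewrite /= nbhs_simpl; apply: filterS => x /dA.
Qed.

Lemma cvg_withinCP (D : set R[i]) (f : R[i] -> R[i]) z l :
  (f x @[x --> within D (nbhs z)] --> l) <->
  forall e : R, 0 < e -> exists2 d : R, 0 < d &
    forall w, D w -> cmod (w - z) < d -> cmod (f w - l) < e.
Proof.
rewrite cvgCP; split=> h e /h; first by move/near_withinC.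
by move=> ?; apply/near_withinC.
Qed.

Lemma cvg_seqCP (u : nat -> R[i]) l :
  (u n @[n --> \oo] --> l) <->
  forall e : R, 0 < e -> exists N, forall n, (N <= n)%N -> cmod (u n - l) < e.
Proof.
rewrite cvgCP; split=> h e /h; first by case=> N _ hN; exists N.
by case=> N hN; exists N.
Qed.

End Modulus.

Section BolzanoWeierstrass.
Variable R : realType.

(** If there were no cluster point, each point would have a square avoided by a tail of [u].
    Cousin's lemma merges such squares into vertical strips, and the strips into the whole square of
    half-side [K], which contains the sequence. *)
Lemma bolzano_weierstrassC (u : nat -> R[i]) (K : R) :
  (forall n, cmod (u n) <= K) ->
  exists l, forall (e : R) N, 0 < e ->
    exists2 n, (N <= n)%N & cmod (u n - l) < e.
Proof.
move=> uK; apply: contrapT => /forallNP nol.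
have K0 : 0 <= K by apply: le_trans (uK 0%N); exact: cmod_ge0.
have loc x y : exists2 d : R, 0 < d & exists N, forall n, (N <= n)%N ->
    ~ (`|Re (u n) - x| < d /\ `|Im (u n) - y| < d).
  have := nol (x +i* y); move/existsNP => -[e] /existsNP[N] /not_implyP[e0 h].
  exists (e / 2); first by lra.
  exists N => n Nn [h1 h2]; apply: h; exists n => //.
  by apply: le_lt_trans (cmod_leD _) _; rewrite ReB ImB /=; lra.
have strip x : exists2 d : R, 0 < d & exists N, forall n, (N <= n)%N ->
    ~ (`|Re (u n) - x| < d /\ - K <= Im (u n) <= K).
  apply: (@cousin _ (- K) K (fun y1 y2 => exists2 d : R, 0 < d &
    exists N, forall n, (N <= n)%N ->
    ~ (`|Re (u n) - x| < d /\ y1 <= Im (u n) <= y2))); first by lra.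
    move=> y1 y2 y3 _ _ [d d0 [N hN]] [d' d'0 [N' hN']].
    exists (Num.min d d'); first by rewrite lt_min d0.
    exists (maxn N N') => n; rewrite geq_max => /andP[nN nN'].
    rewrite lt_min => -[/andP[xd xd'] /andP[h1 h2]].
    have [h|h] := leP (Im (u n)) y2.
      by apply: (hN n) => //; split=> //; rewrite h1.
    by apply: (hN' n) => //; split=> //; rewrite h2 ltW.
  move=> y _; have [d d0 [N hN]] := loc x y; exists d => // y1 y2 _ _ h1 h2 h3 h4.
  exists d => //; exists N => n /hN h [xd h5]; apply: h; split=> //.
  by rewrite ltr_norml; lra.
have [N hN] : exists N, forall n, (N <= n)%N -> ~ (- K <= Re (u n) <= K).
  apply: (@cousin _ (- K) K (fun x1 x2 => exists N, forall n, (N <= n)%N ->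
    ~ (x1 <= Re (u n) <= x2))); first by lra.
    move=> y1 y2 y3 _ _ [N hN] [N' hN'].
    exists (maxn N N') => n; rewrite geq_max => /andP[nN nN'] /andP[h1 h2].
    have [h|h] := leP (Re (u n)) y2.
      by apply: (hN n) => //; rewrite h1.
    by apply: (hN' n) => //; rewrite h2 ltW.
  move=> x _; have [d d0 [N hN]] := strip x; exists d => // x1 x2 _ _ h1 h2 h3 h4.
  exists N => n /hN h h5; apply: h; split; first by rewrite ltr_norml; lra.
  by have := le_trans (cmod_Im (u n)) (uK n); rewrite ler_norml.
apply: (hN N) => //.
by have := le_trans (cmod_Re (u N)) (uK N); rewrite ler_norml.
Qed.

Lemma geometric_cvgC (u : nat -> R[i]) (K : R) :
  (forall n, cmod (u n.+1 - u n) <= K / 2 ^+ n) ->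
  exists l, forall n, cmod (u n - l) <= 2 * K / 2 ^+ n.
Proof.
move=> uK.
have pos n : 0 < 2 ^+ n :> R by rewrite exprn_gt0.
have K0 : 0 <= K.
  by have := uK 0%N; rewrite expr0 divr1; apply: le_trans; exact: cmod_ge0.
(* Subtracting the remaining geometric tail makes the bound reproduce itself in the induction on
   [k]. *)
have uD n k : cmod (u (n + k)%N - u n) <= 2 * K / 2 ^+ n - 2 * K / 2 ^+ (n + k).
  elim: k => [|k IH]; first by rewrite addn0 !subrr cmod0.
  rewrite addnS; apply: le_trans (cmod_tri _ (u (n + k)%N) _) _.
  have := uK (n + k)%N => h.
  have e : 2 * K / 2 ^+ (n + k).+1 = K / 2 ^+ (n + k).
    by rewrite exprS; field; rewrite gt_eqF.
  have e' : 2 * K / 2 ^+ (n + k) = K / 2 ^+ (n + k) + K / 2 ^+ (n + k) by ring.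
  lra.
have uB n k : cmod (u (n + k)%N - u n) <= 2 * K / 2 ^+ n.
  by apply: le_trans (uD n k) _; rewrite gerBl divr_ge0 ?mulr_ge0 // ltW.
have [|l hl] := @bolzano_weierstrassC (fun n => u n) (cmod (u 0%N) + 2 * K).
  move=> n; have := uB 0%N n; rewrite add0n expr0 divr1 => h.
  have := cmodD (u 0%N) (u n - u 0%N); rewrite addrC subrK; lra.
exists l => n; apply/ler_addgt0Pr => e e0.
have [m nm hm] := hl e n e0.
apply: le_trans (cmod_tri _ (u m) _) _; apply: lerD; last exact: ltW.
by rewrite cmodB -(subnKC nm) uB.
Qed.

End BolzanoWeierstrass.

(** * Derivatives along a set *)

Lemma derivable_epsP (K : numFieldType) (f : K -> K) (x l : K) :
  (derivable f x 1 /\ 'D_1 f x = l) <->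
  forall e, 0 < e -> exists2 d, 0 < d & forall y, `|y - x| < d ->
    `|f y - f x - l * (y - x)| <= e * `|y - x|.
Proof.
split.
- move=> [df <-] e e0; have := df; rewrite /derivable => /cvg_ex[l' hl'].
  have -> : 'D_1 f x = l' by apply: cvg_lim.
  have := hl' _ (nbhsx_ballx l' _ e0).
  move=> /nbhs_ballP[d /= d0 hd]; exists d => // y xy.
  have [->|nyx] := eqVneq y x; first by rewrite !subrr mulr0 subrr normr0 mulr0.
  have ny : y - x != 0 by rewrite subr_eq0.
  have := hd (y - x); rewrite /= -ball_normE /= sub0r normrN => /(_ xy ny).
  rewrite /GRing.scale /= mulr1 subrK => /ltW h.
  have -> : f y - f x - l' * (y - x) = - (l' - (y - x)^-1 * (f y - f x)) * (y - x).
    by field.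
  by rewrite normrM normrN ler_pM2r // normr_gt0.
- move=> h.
  have H : (fun h => h^-1 *: ((f \o shift x) (h *: 1) - f x)) @ 0^' --> l.
    apply/cvgrPdist_le => e e0.
    have [d d0 hd] := h e e0.
    near=> k.
    have k0 : k != 0 by near: k; exact: nbhs_dnbhs_neq.
    have kd : `|k| < d.
      near: k; apply: dnbhs0_lt => //.
    have := hd (k + x); rewrite addrK => /(_ kd).
    rewrite /GRing.scale /= mulr1.
    have -> : f (k + x) - f x - l * k = - (l - k^-1 * (f (k + x) - f x)) * k.
      by field.
    by rewrite normrM normrN ler_pM2r // normr_gt0.
  split; first by apply/cvg_ex; exists l.
  exact: cvg_lim H.
Unshelve. all: by end_near. Qed.

Section Cd.
Variable R : realType.
Implicit Types (D E : set R[i]) (f g : R[i] -> R[i]) (z w l : R[i]).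

Definition ct D f z := forall e : R, 0 < e -> exists2 d : R, 0 < d &
  forall w, D w -> cmod (w - z) < d -> cmod (f w - f z) < e.

(* l is the derivative of f at z along D; D need not be open. *)
Definition cd D f z l := forall e : R, 0 < e -> exists2 d : R, 0 < d &
  forall w, D w -> cmod (w - z) < d ->
    cmod (f w - f z - l * (w - z)) <= e * cmod (w - z).

Lemma derivable_cd f z : derivable f z 1 -> cd setT f z (derive1 f z).
Proof.
rewrite /derivable => /cvg_ex[l] hl.
have -> : derive1 f z = l by rewrite derive1E; apply: cvg_lim hl.
move/cvg_withinCP : hl => hl e e0.
have [d d0 hd] := hl e e0; exists d => // w _ wz.
have [->|nw] := eqVneq w z; first by rewrite !subrr mulr0 subrr cmod0 mulr0.
have nw' : w - z != 0 by rewrite subr_eq0.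
have := hd (w - z) nw'; rewrite subr0 => /(_ wz).
rewrite /GRing.scale /= mulr1 subrK => /ltW h.
have -> : f w - f z - l * (w - z) = ((w - z)^-1 * (f w - f z) - l) * (w - z).
  by field.
by rewrite cmodM ler_pM2r // cmod_gt0.
Qed.

Lemma cd_derivable f z l : cd setT f z l -> derivable f z 1 /\ derive1 f z = l.
Proof.
move=> h.
have H : (fun h => h^-1 *: ((f \o shift z) (h *: 1) - f z)) @ 0^' --> l.
  apply/cvg_withinCP => e e0.
  have [|d d0 hd] := h (e / 2); first by lra.
  exists d => // k /= k0; rewrite subr0 => kd.
  have := hd (k + z) I; rewrite addrK => /(_ kd).
  rewrite /GRing.scale /= mulr1.
  have -> : f (k + z) - f z - l * k = (k^-1 * (f (k + z) - f z) - l) * k.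
    by field.
  rewrite cmodM ler_pM2r ?cmod_gt0 // => /le_lt_trans; apply; lra.
split; first by apply/cvg_ex; exists l.
by rewrite derive1E; apply: cvg_lim H.
Qed.

Lemma ct_cst D l z : ct D (fun=> l) z.
Proof. by move=> e e0; exists 1 => // w _ _; rewrite subrr cmod0. Qed.

Lemma ct_id D z : ct D id z.
Proof. by move=> e e0; exists e. Qed.

Lemma ctD D f g z : ct D f z -> ct D g z -> ct D (fun x => f x + g x) z.
Proof.
move=> hf hg e e0; have e20 : 0 < e / 2 by lra.
have [d d0 hd] := hf _ e20; have [d' d'0 hd'] := hg _ e20.
exists (Num.min d d'); first by rewrite lt_min d0.
move=> w Dw; rewrite lt_min => /andP[/(hd w Dw) h1 /(hd' w Dw) h2].
have -> : f w + g w - (f z + g z) = (f w - f z) + (g w - g z) by ring.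
by apply: le_lt_trans (cmodD _ _) _; lra.
Qed.

Lemma ctM D f g z : ct D f z -> ct D g z -> ct D (fun x => f x * g x) z.
Proof.
move=> hf hg e e0.
have f1 : 0 < 2 * (cmod (f z) + 1) by have := cmod_ge0 (f z); lra.
have g1 : 0 < 2 * (cmod (g z) + 1) by have := cmod_ge0 (g z); lra.
have [|d d0 hd] := hf (Num.min 1 (e / (2 * (cmod (g z) + 1)))).
  by rewrite lt_min ltr01 divr_gt0.
have [|d' d'0 hd'] := hg (e / (2 * (cmod (f z) + 1))); first by rewrite divr_gt0.
exists (Num.min d d'); first by rewrite lt_min d0.
move=> w Dw; rewrite lt_min => /andP[/(hd w Dw) + /(hd' w Dw)].
rewrite lt_min => /andP[h1]; rewrite !ltr_pdivlMr // => h2 h3.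
have -> : f w * g w - f z * g z = (f w - f z) * g z + f w * (g w - g z) by ring.
apply: le_lt_trans (cmodD _ _) _; rewrite !cmodM.
have h4 : cmod (f w) <= cmod (f z) + 1.
  have := cmodD (f z) (f w - f z); rewrite addrC subrK; lra.
have h5 : cmod (f w) * cmod (g w - g z) <= (cmod (f z) + 1) * cmod (g w - g z).
  by rewrite ler_wpM2r ?cmod_ge0.
have := cmod_ge0 (f w - f z); have := cmod_ge0 (g z).
set a := cmod (f w - f z) in h2 *; set b := cmod (g w - g z) in h3 h5 *.
move=> h6 h7; nra.
Qed.

Lemma ctV D f z : f z != 0 -> ct D f z -> ct D (fun x => (f x)^-1) z.
Proof.
move=> f0 hf e e0; have n0 : 0 < cmod (f z) by rewrite cmod_gt0.
(* The first bound keeps [cmod (f w)] above [cmod (f z) / 2]; the second then absorbs the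
   denominator [f w * f z]. *)
have [|d d0 hd] := hf (Num.min (cmod (f z) / 2) (e * cmod (f z) ^+ 2 / 2)).
  by rewrite lt_min; apply/andP; split; rewrite divr_gt0 // mulr_gt0 // exprn_gt0.
exists d => // w Dw /(hd w Dw); rewrite lt_min => /andP[h1 h2].
have h3 : cmod (f z) / 2 < cmod (f w).
  have := cmodD (f w) (f z - f w); rewrite addrC subrK [cmod (f z - _)]cmodB; lra.
have fw : f w != 0 by rewrite -cmod_gt0; lra.
have -> : (f w)^-1 - (f z)^-1 = (f z - f w) * (f w * f z)^-1.
  by field; rewrite fw f0.
rewrite cmodM cmodV cmodM cmodB ltr_pdivrMr ?mulr_gt0 ?cmod_gt0 //.
apply: lt_trans h2 _.
rewrite -mulrA ltr_pM2l // expr2 -mulrA [_ * (_ / 2)]mulrC ltr_pM2r //.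
Qed.

Lemma ct_comp D E f g z : (forall w, D w -> E (f w)) ->
  ct D f z -> ct E g (f z) -> ct D (fun x => g (f x)) z.
Proof.
move=> DE hf hg e /hg[d d0 hd]; have [d' d'0 hd'] := hf d d0.
by exists d' => // w Dw wz; apply: hd; [exact: DE|exact: hd'].
Qed.

Lemma ct_opp D z : ct D -%R z.
Proof. by move=> e e0; exists e => // w _; rewrite -opprD cmodN. Qed.

Lemma ct_sub D E f z : D `<=` E -> ct E f z -> ct D f z.
Proof. by move=> DE h e /h[d d0 hd]; exists d => // w /DE; exact: hd. Qed.

(* Caratheodory's form of differentiability *)
Lemma cd_ctP D f z l : cd D f z l <-> exists phi : R[i] -> R[i],
  [/\ ct D phi z, phi z = l & forall w, D w -> f w - f z = phi w * (w - z)].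
Proof.
split=> [h|[phi [cphi phiz hphi]] e e0].
  exists (fun w => if w == z then l else (f w - f z) / (w - z)); split.
  - move=> e e0; have [|d d0 hd] := h (e / 2); first by lra.
    exists d => // w Dw wz; rewrite eqxx.
    have [_|nw] := eqVneq w z; first by rewrite subrr cmod0.
    have nw' : w - z != 0 by rewrite subr_eq0.
    have := hd w Dw wz.
    have -> : f w - f z - l * (w - z) = ((f w - f z) / (w - z) - l) * (w - z).
      by field.
    by rewrite cmodM ler_pM2r ?cmod_gt0 // => /le_lt_trans; apply; lra.
  - by rewrite eqxx.
  - move=> w _; have [->|nw] := eqVneq w z; first by rewrite !subrr mulr0.
    by rewrite divfK // subr_eq0.
have [d d0 hd] := cphi e e0; exists d => // w Dw wz.
rewrite hphi // -phiz -mulrBl cmodM ler_wpM2r ?cmod_ge0 //.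
by apply: ltW; exact: hd.
Qed.

Lemma cd_ct D f z l : cd D f z l -> ct D f z.
Proof.
move=> /cd_ctP[phi [cphi _ hphi]].
have h : ct D (fun w => f z + phi w * (w - z)) z.
  by apply: ctD; [exact: ct_cst|apply: ctM => //; apply: ctD; [exact: ct_id|exact: ct_cst]].
move=> e /h[d d0 hd]; exists d => // w Dw wz.
by have := hd w Dw wz; rewrite subrr mulr0 addr0 -hphi // [f z + _]addrC subrK.
Qed.

Lemma cd_sub D E f z l : D `<=` E -> cd E f z l -> cd D f z l.
Proof. by move=> DE h e /h[d d0 hd]; exists d => // w /DE; exact: hd. Qed.

Lemma cd_near D E f z l (r : R) : 0 < r ->
  (forall w, cmod (w - z) < r -> E w -> D w) -> cd D f z l -> cd E f z l.
Proof.
move=> r0 DE h e /h[d d0 hd]; exists (Num.min d r); first by rewrite lt_min d0.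
by move=> w Ew; rewrite lt_min => /andP[wd wr]; apply: hd => //; exact: DE.
Qed.

Lemma cd_ext D f g z l (r : R) : 0 < r -> f z = g z ->
  (forall w, D w -> cmod (w - z) < r -> f w = g w) -> cd D f z l -> cd D g z l.
Proof.
move=> r0 fgz fg h e /h[d d0 hd]; exists (Num.min d r); first by rewrite lt_min d0.
move=> w Ew; rewrite lt_min => /andP[wd wr].
by rewrite -fgz -fg //; exact: hd.
Qed.

Lemma cd_cst D l z : cd D (fun=> l) z 0.
Proof.
by apply/cd_ctP; exists (fun=> 0); split; [exact: ct_cst| |move=> *; rewrite subrr mul0r].
Qed.

Lemma cd_id D z : cd D id z 1.
Proof.
by apply/cd_ctP; exists (fun=> 1); split; [exact: ct_cst| |move=> *; rewrite mul1r].
Qed.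

Lemma cdD D f g z l m : cd D f z l -> cd D g z m ->
  cd D (fun x => f x + g x) z (l + m).
Proof.
move=> /cd_ctP[p [cp pz hp]] /cd_ctP[q [cq qz hq]].
apply/cd_ctP; exists (fun w => p w + q w); split; [exact: ctD|by rewrite pz qz|].
by move=> w Dw; rewrite mulrDl -hp // -hq //; ring.
Qed.

Lemma cdM D f g z l m : cd D f z l -> cd D g z m ->
  cd D (fun x => f x * g x) z (l * g z + f z * m).
Proof.
move=> hf hg; have cg := cd_ct hg.
move: hf hg => /cd_ctP[p [cp pz hp]] /cd_ctP[q [cq qz hq]].
apply/cd_ctP; exists (fun w => p w * g w + f z * q w); split.
- by apply: ctD; apply: ctM => //; exact: ct_cst.
- by rewrite pz qz.
- move=> w Dw; rewrite mulrDl mulrAC -hp // -mulrA -hq //; ring.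
Qed.

Lemma cdMl D c f z l : cd D f z l -> cd D (fun x => c * f x) z (c * l).
Proof. by move=> h; have := cdM (@cd_cst D c z) h; rewrite mul0r add0r. Qed.

Lemma cdN D f z l : cd D f z l -> cd D (fun x => - f x) z (- l).
Proof.
move=> /(cdMl (-1)); rewrite mulN1r; apply: (@cd_ext _ _ _ _ _ 1) => //.
  by rewrite mulN1r.
by move=> w _ _; rewrite mulN1r.
Qed.

Lemma cdB D f g z l m : cd D f z l -> cd D g z m ->
  cd D (fun x => f x - g x) z (l - m).
Proof. by move=> hf hg; apply: cdD hf (cdN hg). Qed.

Lemma cdV D f z l : (forall w, D w -> f w != 0) -> f z != 0 -> cd D f z l ->
  cd D (fun x => (f x)^-1) z (- l / f z ^+ 2).
Proof.
move=> f0 fz hf; have cf := cd_ct hf; move: hf => /cd_ctP[p [cp pz hp]].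
apply/cd_ctP; exists (fun w => - p w * (f w)^-1 * (f z)^-1); split.
- apply: ctM; last exact: ct_cst.
  apply: ctM; last exact: ctV.
  by apply: (ct_comp (E := setT)) => //; exact: ct_opp.
- by rewrite pz; field.
- move=> w Dw; have fw := f0 w Dw.
  have -> : - p w * (f w)^-1 * (f z)^-1 * (w - z) = - (p w * (w - z)) / f w / f z.
    by field; rewrite fz fw.
  by rewrite -hp //; field; rewrite fz fw.
Qed.

Lemma cd_comp D E f g z l m : (forall w, D w -> E (f w)) ->
  cd D f z l -> cd E g (f z) m -> cd D (fun x => g (f x)) z (m * l).
Proof.
move=> DE hf hg; have cf := cd_ct hf.
move: hf hg => /cd_ctP[p [cp pz hp]] /cd_ctP[q [cq qz hq]].
apply/cd_ctP; exists (fun w => q (f w) * p w); split.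
- by apply: ctM => //; apply: ct_comp DE cf cq.
- by rewrite pz qz.
- by move=> w Dw; rewrite hq; [rewrite hp // mulrA|exact: DE].
Qed.

End Cd.

(** * The mean value inequality and the exponential *)

Section MeanValue.
Variable R : realType.
Implicit Types (D E : set R[i]) (f g : R[i] -> R[i]) (a b z w l : R[i]).

Definition seg a b : set R[i] :=
  [set z | exists2 t : R, 0 <= t <= 1 & z = a + t%:C * (b - a)].

Lemma seg_pt a b (t : R) : 0 <= t -> t <= 1 -> seg a b (a + t%:C * (b - a)).
Proof. by move=> t0 t1; exists t => //; rewrite t0. Qed.

Lemma segl a b : seg a b a.
Proof. by exists 0; rewrite ?lexx ?ler01 // mul0r addr0. Qed.

Lemma segr a b : seg a b b.
Proof. by exists 1; rewrite ?lexx ?ler01 // mul1r addrC subrK. Qed.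

Lemma segC a b : seg a b `<=` seg b a.
Proof.
move=> _ [t t01 ->]; exists (1 - t); first by lra.
by rewrite rmorphB rmorph1; ring.
Qed.

Lemma Re_seg a b (t : R) : Re (a + t%:C * (b - a)) = Re a + t * (Re b - Re a).
Proof. by case: a => ? ?; case: b => ? ?; simpc. Qed.

Lemma Im_seg a b (t : R) : Im (a + t%:C * (b - a)) = Im a + t * (Im b - Im a).
Proof. by case: a => ? ?; case: b => ? ?; simpc. Qed.

(** The slack [e] makes the bound hold for increments between two points on either side of any [t],
    by comparing both with [t]; increments add up, so Cousin's lemma applies. The factor [k] lets
    one real estimate bound a modulus or a signed part. *)
Lemma mean_value_re f (l : R[i] -> R[i]) k a b (K : R) :
  (forall z, seg a b z -> cd (seg a b) f z (l z)) ->
  (forall z, seg a b z -> Re (k * (l z * (b - a))) <= K) ->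
  Re (k * (f b - f a)) <= K.
Proof.
move=> df lK; apply/ler_addgt0Pr => e e0.
pose p (t : R) := a + t%:C * (b - a).
have pB s t : p s - p t = (s - t)%:C * (b - a).
  by rewrite /p rmorphB; ring.
have := @cousin R 0 1 (fun x y => Re (k * (f (p y) - f (p x))) <= (K + e) * (y - x)).
have -> : p 0 = a by rewrite /p mul0r addr0.
have -> : p 1 = b by rewrite /p mul1r addrC subrK.
rewrite subr0 mulr1; apply => //.
  move=> x y z xy yz h1 h2.
  have -> : k * (f (p z) - f (p x)) = k * (f (p z) - f (p y)) + k * (f (p y) - f (p x)).
    by ring.
  rewrite ReD; lra.
move=> t /andP[t0 t1]; have sz : seg a b (p t) by exact: seg_pt.
have kab : 0 <= cmod k * cmod (b - a) by rewrite mulr_ge0 ?cmod_ge0.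
(* The [+ 1] covers the case where [k] or [b - a] is zero. *)
have [|d d0 hd] := df _ sz (e / (cmod k * cmod (b - a) + 1)).
  by rewrite divr_gt0 //; lra.
have ab1 : 0 < cmod (b - a) + 1 by have := cmod_ge0 (b - a); lra.
exists (d / (cmod (b - a) + 1)); first by rewrite divr_gt0.
have near s : 0 <= s -> s <= 1 -> `|s - t| < d / (cmod (b - a) + 1) ->
    `|Re (k * (f (p s) - f (p t))) - (s - t) * Re (k * (l (p t) * (b - a)))|
      <= e * `|s - t|.
  move=> s0 s1 st.
  have := hd (p s) (seg_pt _ _ s0 s1); rewrite pB cmodM cmod_real.
  have sd : `|s - t| * cmod (b - a) < d.
    move: st; rewrite ltr_pdivlMr //; apply: le_lt_trans.
    by rewrite ler_wpM2l //; lra.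
  move=> /(_ sd) h.
  have -> : Re (k * (f (p s) - f (p t))) - (s - t) * Re (k * (l (p t) * (b - a)))
    = Re (k * (f (p s) - f (p t) - l (p t) * ((s - t)%:C * (b - a)))).
    have -> : k * (f (p s) - f (p t) - l (p t) * ((s - t)%:C * (b - a))) =
      k * (f (p s) - f (p t)) - (s - t)%:C * (k * (l (p t) * (b - a))) by ring.
    rewrite ReB; congr (_ - _).
    by case: (k * (l (p t) * (b - a))) => u v; simpc.
  apply: le_trans (cmod_Re _) _; rewrite cmodM.
  apply: le_trans (ler_wpM2l (cmod_ge0 k) h) _.
  have -> : cmod k * (e / (cmod k * cmod (b - a) + 1) * (`|s - t| * cmod (b - a)))
     = (e * `|s - t|) * (cmod k * cmod (b - a) / (cmod k * cmod (b - a) + 1)).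
    by field; lra.
  rewrite ler_piMr ?mulr_ge0 ?(ltW e0) //.
  by rewrite ler_pdivrMr; lra.
have lKt := lK _ sz.
move=> x y x0 y1 tx xt ty yt.
have hx : `|x - t| < d / (cmod (b - a) + 1) by rewrite ltr_norml; lra.
have hy : `|y - t| < d / (cmod (b - a) + 1) by rewrite ltr_norml; lra.
have {hx} := near x x0 (le_trans xt t1) hx.
have {hy} := near y (le_trans t0 ty) y1 hy.
rewrite (ger0_norm (x := y - t)) ?subr_ge0 // (ler0_norm (x := x - t)) ?subr_le0 //.
have -> : k * (f (p y) - f (p x)) = k * (f (p y) - f (p t)) - k * (f (p x) - f (p t)).
  by ring.
rewrite ReB.
set A := Re _; set c := Re _; set B := Re _.
rewrite !ler_norml => /andP[_ h1] /andP[h2 _].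
have yx : 0 <= y - x by rewrite subr_ge0 (le_trans xt).
have h3 : (y - x) * c <= (y - x) * K by apply: ler_wpM2l.
have -> : (K + e) * (y - x) = (y - x) * K + e * (y - x) by ring.
have e1 : (y - t) * c = y * c - t * c by ring.
have e2 : (x - t) * c = x * c - t * c by ring.
have e3 : (y - x) * c = y * c - x * c by ring.
have e4 : e * (y - t) = e * y - e * t by ring.
have e5 : e * - (x - t) = e * t - e * x by ring.
have e6 : e * (y - x) = e * y - e * x by ring.
lra.
Qed.

(** With [k] the conjugate of [f b - f a], the left-hand side of the real estimate becomes the
    squared modulus. *)
Lemma mean_value f (l : R[i] -> R[i]) a b (K : R) :
  (forall z, seg a b z -> cd (seg a b) f z (l z)) ->
  (forall z, seg a b z -> cmod (l z) <= K) ->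
  cmod (f b - f a) <= K * cmod (b - a).
Proof.
move=> df lK; set N := cmod (f b - f a).
have Nsq : Re ((f b - f a)^* * (f b - f a)) = N * N.
  rewrite /N cmod_sqrt -expr2 sqr_sqrtr ?addr_ge0 ?sqr_ge0 //.
  by case: (f b - f a) => u v; simpc => /=; rewrite !expr2.
have cmodJ z : cmod (z^*) = cmod z.
  by rewrite !cmod_sqrt; case: z => u v /=; rewrite sqrrN.
have [->|N0] := eqVneq N 0.
  by rewrite mulr_ge0 ?cmod_ge0 // (le_trans _ (lK a (segl a b))) ?cmod_ge0.
have Npos : 0 < N by rewrite lt_def N0 cmod_ge0.
have := @mean_value_re f l (f b - f a)^* a b (N * (K * cmod (b - a))) df.
rewrite Nsq ler_pM2l //; apply => z sz.
apply: le_trans (ler_norm _) _; apply: le_trans (cmod_Re _) _.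
rewrite !cmodM cmodJ -/N ler_pM2l // ler_wpM2r ?cmod_ge0 //; exact: lK.
Qed.

Lemma mean_value_sub f (l : R[i] -> R[i]) c a b (K : R) :
  (forall z, seg a b z -> cd (seg a b) f z (l z)) ->
  (forall z, seg a b z -> cmod (l z - c) <= K) ->
  cmod (f b - f a - c * (b - a)) <= K * cmod (b - a).
Proof.
move=> df lK.
have -> : f b - f a - c * (b - a) = (f b - c * b) - (f a - c * a) by ring.
apply: (@mean_value (fun z => f z - c * z) (fun z => l z - c)) => // z sz.
apply: cdB; first exact: df.
by have := cdMl c (@cd_id _ (seg a b) z); rewrite mulr1.
Qed.

Lemma cd_eq_cst f a b : (forall z, seg a b z -> cd (seg a b) f z 0) -> f b = f a.
Proof.
move=> df; apply/eqP; rewrite -subr_eq0 -cmod_eq0 eq_le cmod_ge0 andbT.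
have := @mean_value f (fun=> 0) a b 0 df; rewrite mul0r; apply.
by move=> z _; rewrite cmod0.
Qed.

(** [is_derive] is two-sided, hence the assumption that [D] contains a piece of the line on both
    sides of [t]. *)
Lemma is_derive_re D f k a v (t r : R) l : 0 < r ->
  (forall s : R, `|s - t| < r -> D (a + s%:C * v)) ->
  cd D f (a + t%:C * v) l ->
  is_derive t 1 (fun s : R => Re (k * f (a + s%:C * v))) (Re (k * (l * v))).
Proof.
move=> r0 Dr df.
suff [h1 h2] : derivable (fun s : R => Re (k * f (a + s%:C * v))) t 1 /\
  'D_1 (fun s : R => Re (k * f (a + s%:C * v))) t = Re (k * (l * v)).
  by apply: DeriveDef.
apply/derivable_epsP => e e0.
have kv : 0 <= cmod k * cmod v by rewrite mulr_ge0 ?cmod_ge0.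
have [|d d0 hd] := df (e / (cmod k * cmod v + 1)).
  by rewrite divr_gt0 //; lra.
have v1 : 0 < cmod v + 1 by have := cmod_ge0 v; lra.
exists (Num.min r (d / (cmod v + 1))); first by rewrite lt_min r0 divr_gt0.
move=> s; rewrite lt_min => /andP[sr st].
have pB : a + s%:C * v - (a + t%:C * v) = (s - t)%:C * v by rewrite rmorphB; ring.
have := hd _ (Dr _ sr); rewrite pB cmodM cmod_real.
have sd : `|s - t| * cmod v < d.
  move: st; rewrite ltr_pdivlMr //; apply: le_lt_trans.
  by rewrite ler_wpM2l //; lra.
move=> /(_ sd) h; set fs := f _; set ft := f _.
have -> : Re (k * fs) - Re (k * ft) - Re (k * (l * v)) * (s - t) =
   Re (k * (fs - ft - l * ((s - t)%:C * v))).
  have -> : k * (fs - ft - l * ((s - t)%:C * v)) =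
      k * fs - k * ft - (s - t)%:C * (k * (l * v)) by ring.
  rewrite !ReB; congr (_ - _).
  by case: (k * (l * v)) => x y; simpc => /=; rewrite mulrC.
apply: le_trans (cmod_Re _) _; rewrite cmodM.
apply: le_trans (ler_wpM2l (cmod_ge0 k) h) _.
have -> : cmod k * (e / (cmod k * cmod v + 1) * (`|s - t| * cmod v))
   = (e * `|s - t|) * (cmod k * cmod v / (cmod k * cmod v + 1)).
  by field; lra.
rewrite ler_piMr ?mulr_ge0 ?(ltW e0) //.
by rewrite ler_pdivrMr; lra.
Qed.

End MeanValue.

Section Cexp.
Variable R : realType.
Implicit Types (z w : R[i]).

Lemma cexpD z w : cexp (z + w) = cexp z * cexp w.
Proof.
case: z => a b; case: w => c d; rewrite /cexp /=.
rewrite expRD cosD sinD; simpc; apply/eqP; rewrite eq_complex /=.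
by apply/andP; split; apply/eqP; ring.
Qed.

Lemma cexp0 : cexp (0 : R[i]) = 1.
Proof. by rewrite /cexp /= expR0 cos0 sin0 mul1r. Qed.

Lemma cmod_cis (y : R) : cmod (cos y +i* sin y) = 1.
Proof. by rewrite cmod_sqrt /= cos2Dsin2 sqrtr1. Qed.

Lemma cmod_cexp z : cmod (cexp z) = expR (Re z).
Proof. by rewrite cmodM cmod_real cmod_cis mulr1 ger0_norm // expR_ge0. Qed.

Lemma cexp_neq0 z : cexp z != 0.
Proof. by rewrite -cmod_gt0 cmod_cexp expR_gt0. Qed.

Lemma cexpN z : cexp (- z) = (cexp z)^-1.
Proof. by apply: (mulfI (cexp_neq0 z)); rewrite -cexpD subrr cexp0 mulfV // cexp_neq0. Qed.

Lemma is_derive_eps (f : R -> R) (x l : R) : is_derive x 1 f l ->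
  forall e, 0 < e -> exists2 d, 0 < d & forall y, `|y - x| < d ->
    `|f y - f x - l * (y - x)| <= e * `|y - x|.
Proof. by move=> [h1 h2]; apply/derivable_epsP. Qed.

Lemma cd_cexp0 : cd setT (@cexp R) 0 1.
Proof.
move=> e e0.
have e40 : 0 < e / 4 by lra.
have [d1 d10 h1] := is_derive_eps (is_derive_expR (0 : R)) e40.
have [d2 d20 h2] := is_derive_eps (is_derive_cos (0 : R)) e40.
have [d3 d30 h3] := is_derive_eps (is_derive_sin (0 : R)) e40.
(* The bounds [1 / 4] and [e / 8] give [cmod w * (1 + e / 2) <= e / 4], which controls the
   second-order term [x%:C * (T - 1)] below. *)
exists (Num.min (Num.min d1 d2) (Num.min d3 (Num.min (1 / 4) (e / 8)))).
  by rewrite !lt_min d10 d20 d30 /=; lra.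
move=> w _; rewrite subr0 !lt_min => /and3P[/andP[w1 w2] w3 /andP[w4 w5]].
have xw := cmod_Re w; have yw := cmod_Im w.
rewrite cexp0 mul1r /cexp; set x := Re w in xw *; set y := Im w in yw *.
have hs : `|sin y - y| <= e / 4 * `|y|.
  have := h3 y; rewrite sin0 cos0 !subr0 mul1r; apply.
  exact: le_lt_trans yw w3.
have hc : `|cos y - 1| <= e / 4 * `|y|.
  have := h2 y; rewrite sin0 cos0 oppr0 mul0r addr0 subr0; apply.
  exact: le_lt_trans yw w2.
have hx' : `|expR x - 1 - x| <= e / 4 * `|x|.
  have := h1 x; rewrite expR0 !subr0 mul1r; apply.
  exact: le_lt_trans xw w1.
set T := cos y +i* sin y.
have T1 : cmod (T - 1 - y *i) <= e / 2 * cmod w.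
  apply: le_trans (cmod_leD _) _; rewrite !ReB !ImB /= !subr0.
  have := ler_wpM2l (ltW e40) yw; lra.
have T2 : cmod (T - 1) <= cmod w * (1 + e / 2).
  have -> : T - 1 = (T - 1 - y *i) + y *i by ring.
  apply: le_trans (cmodD _ _) _.
  have : cmod (y *i) <= cmod w by rewrite cmod_sqrt /= expr0n add0r sqrtr_sqr.
  by rewrite mulrDr mulr1; lra.
have -> : (expR x)%:C * T - 1 - w =
  (expR x - 1 - x)%:C * T + (T - 1 - y *i) + x%:C * (T - 1).
  have -> : w = x%:C + y *i by rewrite /x /y; case: (w) => u v; simpc.
  by rewrite !rmorphB rmorph1; ring.
apply: le_trans (cmodD _ _) _.
have : cmod ((expR x - 1 - x)%:C * T + (T - 1 - y *i)) <= e / 4 * cmod w + e / 2 * cmod w.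
  apply: le_trans (cmodD _ _) _; apply: lerD => //.
  rewrite cmodM cmod_cis mulr1 cmod_real; apply: le_trans hx' _.
  by rewrite ler_wpM2l // ltW.
have : cmod (x%:C * (T - 1)) <= e / 4 * cmod w.
  rewrite cmodM cmod_real.
  apply: (@le_trans _ _ (cmod w * (cmod w * (1 + e / 2)))).
    by apply: ler_pM => //; rewrite cmod_ge0.
  rewrite mulrC ler_wpM2r ?cmod_ge0 //; nra.
have -> : e * cmod w = e / 4 * cmod w + e / 2 * cmod w + e / 4 * cmod w by field.
lra.
Qed.

End Cexp.

(** * Goursat's lemma and primitives on convex sets *)

Section RealCalculus.
Variable R : realType.
Implicit Types (f F u : R -> R) (a b x t : R).

Lemma real_contP f x : {for x, continuous f} <->
  forall e, 0 < e -> exists2 d, 0 < d & forall y, `|y - x| < d -> `|f y - f x| < e.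
Proof.
split=> [h e e0|h].
  have := h _ (nbhsx_ballx (f x) _ e0).
  move=> /nbhs_ballP[d /= d0 hd]; exists d => // y xy.
  have /hd : ball x d y by rewrite -ball_normE /= distrC.
  by rewrite /= -ball_normE /= distrC.
apply/cvgrPdist_lt => e /h[d d0 hd]; apply/nbhs_ballP; exists d => //= y xy.
rewrite /= distrC; apply: hd; move: xy; by rewrite distrC.
Qed.

Lemma is_derive_continuous f x l : is_derive x 1 f l -> {for x, continuous f}.
Proof. by move=> [h _]; apply/differentiable_continuous/derivable1_diffP. Qed.

Lemma antiderivative u : continuous u ->
  exists F, forall t, 0 <= t <= 1 -> is_derive t 1 F (u t).
Proof.
(* Integrating from -1, inside an interval ending at 2, makes the derivative two-sided at 0 and at 1
   as well. *)
move=> cu; exists (fun x => \int[lebesgue_measure]_(t in `[-1, x]) u t) => t /andP[t0 t1].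
have [|||h1 h2] := @continuous_FTC1_closed R u (-1) t 2 _ _ _ (cu t); [lra| |lra|].
  apply: continuous_compact_integrable; first exact: segment_compact.
  exact: continuous_subspaceT.
by apply: DeriveDef; [exact: h1|rewrite -derive1E; exact: h2].
Qed.

Lemma FTC2_real f F a b : a < b ->
  (forall t, a <= t <= b -> {for t, continuous f}) ->
  (forall t, a <= t <= b -> is_derive t 1 F (f t)) ->
  (\int[lebesgue_measure]_(t in `[a, b]) (f t)%:E = (F b - F a)%:E)%E.
Proof.
move=> ab cf dF; have cF t : a <= t <= b -> {for t, continuous F}.
  by move=> /dF; exact: is_derive_continuous.
rewrite EFinB; apply: continuous_FTC2 => //.
- apply/subspace_continuousP => t; rewrite /= in_itv /= => /cf h.
  exact: cvg_within_filter.
- split.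
  + move=> t; rewrite in_itv /= => /andP[/ltW h1 /ltW h2].
    by have [] := dF t; rewrite ?h1 ?h2.
  + by apply: cvg_at_right_filter; apply: cF; rewrite lexx ltW.
  + by apply: cvg_at_left_filter; apply: cF; rewrite lexx ltW.
- move=> t; rewrite in_itv /= => /andP[/ltW h1 /ltW h2].
  by rewrite derive1E; have [] := dF t; rewrite ?h1 ?h2.
Qed.

End RealCalculus.

Section LineIntegral.
Variable R : realType.
Implicit Types (D E K : set R[i]) (f g h U : R[i] -> R[i]) (a b c z w l I : R[i]).

Definition convex D := forall a b, D a -> D b -> seg a b `<=` D.

(* The integral of h over [a, b], as the increment of a primitive of h along
   the segment. *)
Definition lint h a b I := exists2 U,
  (forall z, seg a b z -> cd (seg a b) U z (h z)) & I = U b - U a.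

Lemma convex_seg a b : convex (seg a b).
Proof.
move=> _ _ [s /andP[s0 s1] ->] [t /andP[t0 t1] ->] _ [v /andP[v0 v1] ->].
exists (s + v * (t - s)); last by rewrite rmorphD rmorphM rmorphB; ring.
by apply/andP; split; nra.
Qed.

Lemma cmod_seg a b z : seg a b z -> cmod (z - a) <= cmod (b - a).
Proof.
move=> [t /andP[t0 t1] ->]; rewrite addrC addKr cmodM cmod_real ger0_norm //.
by rewrite ler_piMl ?cmod_ge0.
Qed.

(** Real antiderivatives of the real and imaginary parts, taken in the parameter, are transported
    back to the segment. *)
Lemma lint_exists h a b : (forall z, seg a b z -> ct (seg a b) h z) ->
  exists I, lint h a b I.
Proof.
move=> ch; have [->|nab] := eqVneq b a.
  exists (0 - 0), (fun=> 0) => // _ [t _ ->] e e0; exists 1 => // _ [s _ ->] _.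
  by rewrite !subrr !mulr0 addr0 !subrr mulr0 subrr cmod0 mulr0.
pose p (t : R) := a + t%:C * (b - a).
(* [clamp] extends the integrand continuously from [[0, 1]] to the line, as [antiderivative]
   requires. *)
pose clamp (t : R) : R := if t <= 0 then 0 else if 1 <= t then 1 else t.
have clamp01 t : 0 <= clamp t <= 1.
  by rewrite /clamp; case: (lerP t 0) => ?; [|case: (lerP 1 t) => ?]; lra.
have clampE t : 0 <= t <= 1 -> clamp t = t.
  by move=> ?; rewrite /clamp; case: (lerP t 0) => ?; [|case: (lerP 1 t) => ?]; lra.
have clampL s t : `|clamp s - clamp t| <= `|s - t|.
  rewrite ler_norml; have := ler_norm (s - t); have := ler_norm (t - s).
  rewrite [`|t - s|]distrC /clamp.
  case: (lerP s 0) => ?; [|case: (lerP 1 s) => ?];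
  (case: (lerP t 0) => ?; [|case: (lerP 1 t) => ?]); lra.
have ab0 : 0 < cmod (b - a) by rewrite cmod_gt0 subr_eq0.
have cu (k : R[i]) : continuous (fun t : R => Re (k * (h (p (clamp t)) * (b - a)))).
  move=> t; apply/real_contP => e e0.
  have kb : 0 <= cmod k * cmod (b - a) by rewrite mulr_ge0 ?cmod_ge0.
  have /andP[c0 c1] := clamp01 t.
  have [||d d0 hd] := ch (p (clamp t)) _ (e / (cmod k * cmod (b - a) + 1)).
  - exact: seg_pt.
  - by rewrite divr_gt0 //; lra.
  exists (d / cmod (b - a)); first by rewrite divr_gt0.
  move=> s; rewrite ltr_pdivlMr // => st.
  have /andP[s0 s1] := clamp01 s.
  have := hd (p (clamp s)) (seg_pt _ _ s0 s1).
  have -> : p (clamp s) - p (clamp t) = (clamp s - clamp t)%:C * (b - a).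
    by rewrite /p rmorphB; ring.
  rewrite cmodM cmod_real.
  have h1 : `|clamp s - clamp t| * cmod (b - a) < d.
    by apply: le_lt_trans st; rewrite ler_wpM2r ?cmod_ge0.
  move=> /(_ h1); rewrite ltr_pdivlMr; last by lra.
  move=> h2; rewrite -ReB; apply: le_lt_trans (cmod_Re _) _.
  have -> : k * (h (p (clamp s)) * (b - a)) - k * (h (p (clamp t)) * (b - a)) =
    k * (h (p (clamp s)) - h (p (clamp t))) * (b - a) by ring.
  rewrite !cmodM; apply: le_lt_trans h2.
  have := cmod_ge0 (h (p (clamp s)) - h (p (clamp t))).
  set u := cmod (_ - _); nra.
(* The factors [1] and [- 'i] select the real and the imaginary part. *)
have [V hV] := antiderivative (cu 1).
have [W hW] := antiderivative (cu (- 'i)).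
(* [tau] recovers the parameter from a point of the segment. *)
pose tau z := Re ((z - a) / (b - a)).
pose U z := V (tau z) +i* W (tau z).
exists (U b - U a), U => //.
have tauE t : tau (p t) = t.
  by rewrite /tau /p addrC addKr mulfK ?subr_eq0.
move=> _ [t t01 ->] e e0; rewrite -/(p t).
have e2 : 0 < e / 2 * cmod (b - a) by rewrite mulr_gt0 //; lra.
have [d d0 hd] := is_derive_eps (hV t t01) e2.
have [d' d'0 hd'] := is_derive_eps (hW t t01) e2.
exists (Num.min d d' * cmod (b - a)); first by rewrite mulr_gt0 // lt_min d0.
move=> _ [s s01 ->]; rewrite -/(p s).
have -> : p s - p t = (s - t)%:C * (b - a) by rewrite /p rmorphB; ring.
rewrite cmodM cmod_real ltr_pM2r // lt_min => /andP[/hd h1 /hd' h2].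
rewrite /U !tauE.
apply: le_trans (cmod_leD _) _.
move: h1 h2; rewrite clampE //; set X := h (p t).
rewrite !ReB !ImB mul1r /=.
have -> : Re (X * ((s - t)%:C * (b - a))) = Re (X * (b - a)) * (s - t).
  by rewrite mulrCA mulrC; case: (X * (b - a)) => x y; simpc.
have -> : Im (X * ((s - t)%:C * (b - a))) = Re (- 'i * (X * (b - a))) * (s - t).
  by rewrite mulrCA; case: (X * (b - a)) => x y; simpc => /=; rewrite mulrC.
have -> : e * (`|s - t| * cmod (b - a)) =
   e / 2 * cmod (b - a) * `|s - t| + e / 2 * cmod (b - a) * `|s - t| by field.
exact: lerD.
Qed.

Lemma lint_uniq h a b I J : lint h a b I -> lint h a b J -> I = J.
Proof.
move=> [U hU ->] [V hV ->].
have := @cd_eq_cst R (fun z => U z - V z) a b.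
move=> H; have {}H : U b - V b = U a - V a.
  by apply: H => z sz; rewrite -(subrr (h z)); apply: cdB; [exact: hU|exact: hV].
by rewrite -[U b](subrK (V b)) H; ring.
Qed.

Lemma lint_sub h a b c I J (K : R[i]) : seg a b c -> lint h a b I -> lint h a c J ->
  lint h c b K -> I = J + K.
Proof.
move=> sc [U hU ->] hJ hK.
have h1 : seg a c `<=` seg a b by apply: convex_seg => //; exact: segl.
have h2 : seg c b `<=` seg a b by apply: convex_seg => //; exact: segr.
have -> : J = U c - U a.
  apply: lint_uniq hJ _; exists U => // z sz.
  by apply: (cd_sub h1); apply: hU; exact: h1.
have -> : K = U b - U c.
  apply: lint_uniq hK _; exists U => // z sz.
  by apply: (cd_sub h2); apply: hU; exact: h2.
by ring.
Qed.

Lemma lintC h a b I : lint h a b I -> lint h b a (- I).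
Proof.
move=> [U hU ->]; exists U; last by rewrite opprB.
move=> z sz; apply: cd_sub (@segC _ b a) _; apply: hU; exact: segC.
Qed.

(** The subtracted terms form the increment of a primitive of the affine function [p + q * (z - c)];
    around a closed polygon they cancel, and only the errors remain. *)
Lemma lint_est h a b c p q I (K : R) : lint h a b I ->
  (forall z, seg a b z -> cmod (h z - p - q * (z - c)) <= K) ->
  cmod (I - ((p * b + q / 2 * ((b - c) * (b - c))) -
             (p * a + q / 2 * ((a - c) * (a - c))))) <= K * cmod (b - a).
Proof.
move=> [U hU ->] hK.
pose Q z := p * z + q / 2 * ((z - c) * (z - c)).
have -> : U b - U a - ((p * b + q / 2 * ((b - c) * (b - c))) -
             (p * a + q / 2 * ((a - c) * (a - c)))) = (U b - Q b) - (U a - Q a).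
  by rewrite /Q; ring.
apply: (@mean_value _ (fun z => U z - Q z) (fun z => h z - p - q * (z - c))) => //.
move=> z sz.
have -> : h z - p - q * (z - c) =
  h z - (p * 1 + q / 2 * ((1 - 0) * (z - c) + (z - c) * (1 - 0))) by field.
apply: cdB; first exact: hU.
have h1 : cd (seg a b) (fun z => z - c) z (1 - 0).
  by apply: cdB; [exact: cd_id|exact: cd_cst].
by apply: cdD; apply: cdMl; [exact: cd_id|exact: cdM].
Qed.

End LineIntegral.

Section Goursat.
Variables (R : realType) (h : R[i] -> R[i]) (K : set R[i]).
Hypothesis convex_K : convex K.
Hypothesis closed_K : forall z : R[i],
  (forall e : R, 0 < e -> exists2 w, K w & cmod (w - z) < e) -> K z.
Hypothesis diff_h : forall z, K z -> exists l, cd K h z l.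
Implicit Types (a b c z w : R[i]).

Lemma line_int_exists a b : K a -> K b -> exists I, lint h a b I.
Proof.
move=> Ka Kb; apply: lint_exists => z sz.
have sK : seg a b `<=` K by exact: convex_K.
have [l hl] := diff_h (sK _ sz).
exact: ct_sub sK (cd_ct hl).
Qed.

(** The value is unique by [lint_uniq]; 0 is the default when [h] has no primitive along the
    segment. *)
Definition line_int (h : R[i] -> R[i]) a b := xget 0 [set I | lint h a b I].

Lemma line_intP a b : K a -> K b -> lint h a b (line_int h a b).
Proof. by move=> Ka Kb; have [I hI] := line_int_exists Ka Kb; exact: (@xgetI _ 0 _ I). Qed.

Lemma line_intC a b : K a -> K b -> line_int h b a = - line_int h a b.
Proof.
by move=> Ka Kb; apply: lint_uniq (line_intP Kb Ka) (lintC (line_intP Ka Kb)).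
Qed.

Definition mid a b : R[i] := a + (1 / 2)%:C * (b - a).

Lemma half_real : (1 / 2)%:C = 1 / 2 :> R[i].
Proof. by rewrite rmorphM rmorph1 fmorphV rmorphMn. Qed.

Lemma mid_K a b : K a -> K b -> K (mid a b).
Proof. by move=> Ka Kb; apply: (convex_K Ka Kb); apply: seg_pt; lra. Qed.

Lemma line_int_mid a b : K a -> K b ->
  line_int h a b = line_int h a (mid a b) + line_int h (mid a b) b.
Proof.
move=> Ka Kb; have Km := mid_K Ka Kb.
have sm : seg a b (mid a b) by apply: seg_pt; lra.
exact: (lint_sub sm (line_intP Ka Kb) (line_intP Ka Km) (line_intP Km Kb)).
Qed.

Definition tri (T : R[i] * R[i] * R[i]) :=
  line_int h T.1.1 T.1.2 + line_int h T.1.2 T.2 + line_int h T.2 T.1.1.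
Definition per (T : R[i] * R[i] * R[i]) :=
  cmod (T.1.2 - T.1.1) + cmod (T.2 - T.1.2) + cmod (T.1.1 - T.2).
Definition inK (T : R[i] * R[i] * R[i]) := [/\ K T.1.1, K T.1.2 & K T.2].

Lemma per_ge0 T : 0 <= per T.
Proof. by rewrite !addr_ge0 ?cmod_ge0. Qed.

Lemma cmod_half z : cmod (1 / 2 * z) = cmod z / 2.
Proof.
by rewrite cmodM -half_real cmod_real ger0_norm; [ring|lra].
Qed.

Definition bad (e : R) T := inK T /\ e * per T ^+ 2 < cmod (tri T).

(** The midpoints cut [T] into four triangles of half the perimeter, and the integrals over the
    inner edges cancel. If all four satisfied the bound, which is then divided by 4, so would [T].
    The last clause makes the first vertices of the iterated triangles converge geometrically. *)
Lemma goursat_step (e : R) T : bad e T -> exists T',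
  [/\ bad e T', per T' = per T / 2 & cmod (T'.1.1 - T.1.1) <= per T].
Proof.
case: T => [[a b] c] [[/= Ka Kb Kc] hT].
pose u := mid a b; pose v := mid b c; pose w := mid c a.
have Ku : K u by exact: mid_K.
have Kv : K v by exact: mid_K.
have Kw : K w by exact: mid_K.
have uE : u = 1 / 2 * (a + b) by rewrite /u /mid half_real; field.
have vE : v = 1 / 2 * (b + c) by rewrite /v /mid half_real; field.
have wE : w = 1 / 2 * (c + a) by rewrite /w /mid half_real; field.
have sumE : tri (a, b, c) = tri (a, u, w) + tri (u, b, v) + tri (w, v, c) + tri (u, v, w).
  rewrite /tri /= (line_int_mid Ka Kb) (line_int_mid Kb Kc) (line_int_mid Kc Ka).
  rewrite -/u -/v -/w (line_intC Kw Ku) (line_intC Ku Kv) (line_intC Kv Kw).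
  by ring.
have hE (x y z : R[i]) : x - y = 1 / 2 * z -> cmod (x - y) = cmod z / 2.
  by move=> ->; rewrite cmod_half.
have uaE : cmod (u - a) = cmod (b - a) / 2 by apply: hE; rewrite uE; field.
have buE : cmod (b - u) = cmod (b - a) / 2 by apply: hE; rewrite uE; field.
have vbE : cmod (v - b) = cmod (c - b) / 2 by apply: hE; rewrite vE; field.
have cvE : cmod (c - v) = cmod (c - b) / 2 by apply: hE; rewrite vE; field.
have wcE : cmod (w - c) = cmod (a - c) / 2 by apply: hE; rewrite wE; field.
have awE : cmod (a - w) = cmod (a - c) / 2 by apply: hE; rewrite wE; field.
have vuE : cmod (v - u) = cmod (a - c) / 2.
  by rewrite cmodB; apply: hE; rewrite uE vE; field.
have wvE : cmod (w - v) = cmod (b - a) / 2.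
  by rewrite cmodB; apply: hE; rewrite vE wE; field.
have uwE : cmod (u - w) = cmod (c - b) / 2.
  by rewrite cmodB; apply: hE; rewrite uE wE; field.
have p1 : per (a, u, w) = per (a, b, c) / 2.
  by rewrite /per /= uaE [cmod (w - u)]cmodB uwE awE; ring.
have p2 : per (u, b, v) = per (a, b, c) / 2.
  by rewrite /per /= buE vbE [cmod (u - v)]cmodB vuE; ring.
have p3 : per (w, v, c) = per (a, b, c) / 2.
  by rewrite /per /= [cmod (v - w)]cmodB wvE cvE wcE; ring.
have p4 : per (u, v, w) = per (a, b, c) / 2.
  by rewrite /per /= vuE wvE uwE; ring.
have ge0 (x y : R[i]) : 0 <= cmod (x - y) :> R by exact: cmod_ge0.
have bnd : per (a, b, c) = cmod (b - a) + cmod (c - b) + cmod (a - c) by [].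
have ua : cmod (u - a) <= per (a, b, c).
  by have := ge0 b a; have := ge0 c b; have := ge0 a c; rewrite bnd uaE; lra.
have wa : cmod (w - a) <= per (a, b, c).
  by have := ge0 b a; have := ge0 c b; have := ge0 a c; rewrite bnd [cmod (w - a)]cmodB awE; lra.
apply: contrapT => /forallNP no.
have key T' : inK T' -> per T' = per (a, b, c) / 2 ->
    cmod (T'.1.1 - a) <= per (a, b, c) ->
    cmod (tri T') <= e * per (a, b, c) ^+ 2 / 4.
  move=> KT pT aT; rewrite leNgt; apply/negP => lt.
  apply: (no T'); split => //; split => //; rewrite pT.
  by have -> : e * (per (a, b, c) / 2) ^+ 2 = e * per (a, b, c) ^+ 2 / 4 by field.
have t1 : cmod (tri (a, u, w)) <= e * per (a, b, c) ^+ 2 / 4.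
  by apply: key => //=; rewrite subrr cmod0 per_ge0.
have t2 : cmod (tri (u, b, v)) <= e * per (a, b, c) ^+ 2 / 4 by exact: key.
have t3 : cmod (tri (w, v, c)) <= e * per (a, b, c) ^+ 2 / 4 by exact: key.
have t4 : cmod (tri (u, v, w)) <= e * per (a, b, c) ^+ 2 / 4 by exact: key.
move: hT; rewrite sumE.
have := cmodD (tri (a, u, w) + tri (u, b, v) + tri (w, v, c)) (tri (u, v, w)).
have := cmodD (tri (a, u, w) + tri (u, b, v)) (tri (w, v, c)).
have := cmodD (tri (a, u, w)) (tri (u, b, v)).
lra.
Qed.

Lemma goursat T : inK T -> tri T = 0.
Proof.
move=> KT; apply/eqP; rewrite -cmod_eq0; apply: contraT => nz.
have tpos : 0 < cmod (tri T) by rewrite lt_def nz cmod_ge0.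
(* With this [e] the triangle [T] itself is bad; the [+ 1] covers perimeter zero. *)
pose e := cmod (tri T) / (per T ^+ 2 + 1).
have p2 : 0 <= per T ^+ 2 by rewrite sqr_ge0.
have e0 : 0 < e by rewrite divr_gt0 //; lra.
have badT : bad e T.
  split => //; rewrite /e mulrAC ltr_pdivrMr; last by lra.
  by rewrite ltr_pM2l //; lra.
have [nx nxP] : {nx & forall T, bad e T -> [/\ bad e (nx T), per (nx T) = per T / 2
    & cmod ((nx T).1.1 - T.1.1) <= per T]}.
  apply: (@choice _ _ (fun T T' => bad e T -> [/\ bad e T', per T' = per T / 2
    & cmod (T'.1.1 - T.1.1) <= per T])) => S.
  have [/goursat_step[S' hS']|nb] := pselect (bad e S); first by exists S'.
  by exists S => /nb.
pose Tn n := iter n nx T.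
have badn n : bad e (Tn n) by elim: n => [|n IH] //=; have [] := nxP _ IH.
have pern n : per (Tn n) = per T / 2 ^+ n.
  elim: n => [|n IH] /=; first by rewrite expr0 divr1.
  have [_ -> _] := nxP _ (badn n); rewrite IH exprS.
  by field; rewrite expf_neq0.
have [l hl] : exists l, forall n, cmod ((Tn n).1.1 - l) <= 2 * per T / 2 ^+ n.
  apply: (@geometric_cvgC _ (fun n => (Tn n).1.1)) => n.
  by rewrite -pern; have [] := nxP _ (badn n).
have small (d : R) : 0 < d -> exists n, 3 * (per T / 2 ^+ n) < d.
  move=> d0; have [n hn] : exists n, 3 * per T / d < n%:R.
    by exists (Num.truncn (3 * per T / d)).+1; exact: truncnS_gt.
  exists n; rewrite mulrA ltr_pdivrMr ?exprn_gt0 //.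
  rewrite ltr_pdivrMr // in hn; rewrite [d * _]mulrC; apply: lt_le_trans hn _.
  by rewrite ler_wpM2r ?(ltW d0) // -natrX ler_nat ltnW // ltn_expl.
(* Closedness of [K] places the limit of the triangles at a point where [h] is differentiable. *)
have Kl : K l.
  apply: closed_K => d /small[n hn]; exists (Tn n).1.1; first by have [[]] := badn n.
  apply: le_lt_trans (hl n) _; apply: le_lt_trans hn.
  rewrite mulrA ler_wpM2r ?invr_ge0 ?exprn_ge0 // ler_wpM2r ?per_ge0 //; lra.
have [q hq] := diff_h Kl.
have e4 : 0 < e / 4 by lra.
have [d d0 hd] := hq _ e4.
have [n hn] := small d d0.
have [[]] := badn n.
have := pern n; have := hl n; set p := per T / 2 ^+ n in hn *.
rewrite -mulrA -/p; move: (Tn n) => [[a b] c] /= lal pS Ka Kb Kc.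
have pE : per (a, b, c) = cmod (b - a) + cmod (c - b) + cmod (a - c) by [].
have ba0 := cmod_ge0 (b - a); have cb0 := cmod_ge0 (c - b); have ac0 := cmod_ge0 (a - c).
(* A side is at most half the perimeter; this gives the bound [3 * p] for the side from [c] back to
   [a]. *)
have tri_ac := cmod_tri c b a; rewrite [cmod (c - a)]cmodB in tri_ac.
have lb : cmod (b - l) <= 2 * p + cmod (b - a).
  by apply: le_trans (cmod_tri _ a _) _; lra.
have lc : cmod (c - l) <= 2 * p + cmod (a - c).
  by apply: le_trans (cmod_tri _ a _) _; rewrite [cmod (c - a)]cmodB; lra.
have p0 : 0 <= p by rewrite -pS per_ge0.
(* Every side stays within [3 * p] of [l], so the affine approximation of [h] errs by at most
   [e / 4 * (3 * p)]. Over the whole triangle this gives [3 / 4] of [e * p ^+ 2], whereas a bad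
   triangle exceeds [e * p ^+ 2]. *)
have est x y : K x -> K y -> cmod (x - l) + cmod (y - x) <= 3 * p ->
    cmod (line_int h x y - ((h l * y + q / 2 * ((y - l) * (y - l))) -
             (h l * x + q / 2 * ((x - l) * (x - l))))) <= e / 4 * (3 * p) * cmod (y - x).
  move=> Kx Ky xy; apply: lint_est; first exact: line_intP.
  move=> z sz.
  have zl : cmod (z - l) <= 3 * p.
    apply: le_trans (cmod_tri _ x _) _; have := cmod_seg sz; lra.
  have := hd z (convex_K Kx Ky sz); move=> /(_ (le_lt_trans zl hn)) /le_trans; apply.
  by rewrite ler_wpM2l // ltW.
have E1 := est a b Ka Kb; have E2 := est b c Kb Kc; have E3 := est c a Kc Ka.
rewrite pS; rewrite pE in pS.
have {}E1 : cmod (line_int h a b - ((h l * b + q / 2 * ((b - l) * (b - l))) -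
             (h l * a + q / 2 * ((a - l) * (a - l))))) <= e / 4 * (3 * p) * cmod (b - a).
  apply: E1; lra.
have {}E2 : cmod (line_int h b c - ((h l * c + q / 2 * ((c - l) * (c - l))) -
             (h l * b + q / 2 * ((b - l) * (b - l))))) <= e / 4 * (3 * p) * cmod (c - b).
  apply: E2; lra.
have {}E3 : cmod (line_int h c a - ((h l * a + q / 2 * ((a - l) * (a - l))) -
             (h l * c + q / 2 * ((c - l) * (c - l))))) <= e / 4 * (3 * p) * cmod (a - c).
  apply: E3; lra.
set X := line_int h a b - _ in E1; set Y := line_int h b c - _ in E2.
set Z := line_int h c a - _ in E3.
have -> : tri (a, b, c) = X + Y + Z by rewrite /tri /X /Y /Z /=; ring.
have := cmodD (X + Y) Z; have := cmodD X Y => D1 D2.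
have : cmod (X + Y + Z) <= e / 4 * (3 * p) * p.
  have -> : e / 4 * (3 * p) * p = e / 4 * (3 * p) * cmod (b - a) +
     e / 4 * (3 * p) * cmod (c - b) + e / 4 * (3 * p) * cmod (a - c).
    by rewrite -{2}pS; ring.
  lra.
have : 0 <= e * p ^+ 2 by rewrite mulr_ge0 ?sqr_ge0 // ltW.
have -> : e / 4 * (3 * p) * p = 3 / 4 * (e * p ^+ 2) by field.
lra.
Qed.

(** By Goursat's lemma the increment from [z] to [w] is the integral over [[z, w]], where [h] is
    close to [h z]. *)
Lemma cd_line_int z0 z : K z0 -> K z -> cd K (line_int h z0) z (h z).
Proof.
move=> K0 Kz e e0.
have [l hl] := diff_h Kz.
have [d d0 hd] := cd_ct hl e0.
exists d => // w Kw wz.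
have := @goursat (z0, z, w) (And3 K0 Kz Kw); rewrite /tri /= => t0.
have -> : line_int h z0 w - line_int h z0 z = line_int h z w.
  by rewrite (line_intC K0 Kw) in t0; apply/eqP; rewrite -subr_eq0 -oppr_eq0 -t0; apply/eqP; ring.
have := @lint_est _ h z w z (h z) 0 _ e (line_intP Kz Kw).
rewrite mul0r !mul0r !addr0 -mulrBr; apply => x sx.
rewrite mul0r subr0; apply/ltW/hd; first exact: (convex_K Kz Kw sx).
exact: le_lt_trans (cmod_seg sx) wz.
Qed.

End Goursat.

(** * Local inverses and lifts *)

Section Primitive0.
Variable R : realType.
Implicit Types (D : set R[i]) (f h H : R[i] -> R[i]) (a k v z w l : R[i]).

Lemma ct_re_continuous D f k a v (t r : R) : 0 < r ->
  (forall s : R, `|s - t| < r -> D (a + s%:C * v)) ->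
  ct D f (a + t%:C * v) -> {for t, continuous (fun s : R => Re (k * f (a + s%:C * v)))}.
Proof.
move=> r0 Dr cf; apply/real_contP => e e0.
have k1 : 0 < cmod k + 1 by have := cmod_ge0 k; lra.
have v1 : 0 < cmod v + 1 by have := cmod_ge0 v; lra.
have [|d d0 hd] := cf (e / (cmod k + 1)); first by rewrite divr_gt0.
exists (Num.min r (d / (cmod v + 1))); first by rewrite lt_min r0 divr_gt0.
move=> s; rewrite lt_min => /andP[sr st].
have pB : a + s%:C * v - (a + t%:C * v) = (s - t)%:C * v by rewrite rmorphB; ring.
have := hd _ (Dr _ sr); rewrite pB cmodM cmod_real.
have sd : `|s - t| * cmod v < d.
  move: st; rewrite ltr_pdivlMr //; apply: le_lt_trans.
  by rewrite ler_wpM2l //; lra.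
move=> /(_ sd); rewrite ltr_pdivlMr // => h.
rewrite -ReB -mulrBr; apply: le_lt_trans (cmod_Re _) _; rewrite cmodM.
apply: le_lt_trans h; rewrite mulrC ler_wpM2l ?cmod_ge0 //; lra.
Qed.

Lemma FTC2_line D H h k a v (x y : R) : x < y ->
  (forall t, x <= t <= y -> exists2 r : R, 0 < r &
     forall s : R, `|s - t| < r -> D (a + s%:C * v)) ->
  (forall z, D z -> cd D H z (h z)) -> (forall z, D z -> ct D h z) ->
  (\int[lebesgue_measure]_(t in `[x, y]) (Re (k * (h (a + t%:C * v) * v)))%:E =
   (Re (k * H (a + y%:C * v)) - Re (k * H (a + x%:C * v)))%:E)%E.
Proof.
move=> xy Dxy dH ch.
have Dt t : x <= t <= y -> D (a + t%:C * v).
  by move=> /Dxy[r r0]; apply; rewrite subrr normr0.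
apply: (@FTC2_real _ _ (fun t => Re (k * H (a + t%:C * v)))) => // t xty;
  have [r r0 hr] := Dxy t xty.
- have -> : (fun t : R => Re (k * (h (a + t%:C * v) * v))) =
    (fun t : R => Re (k * v * h (a + t%:C * v))).
    by apply/funext => s; congr Re; ring.
  by apply: (ct_re_continuous r0 hr); apply/ch/Dt.
- by apply: (is_derive_re k r0 hr); apply/dH/Dt.
Qed.

Lemma primitive0E H h z : (forall z, cd setT H z (h z)) ->
  (forall z, ct setT h z) -> primitive0 h z = H z - H 0.
Proof.
move=> dH ch; rewrite /primitive0 /cintegral.
have E k : (\int[lebesgue_measure]_(t in `[0, 1]) Re (k * (h (t%:C * z) * z)))%R =
   Re (k * H z) - Re (k * H 0).
  have := @FTC2_line setT H h k 0 z 0 1 ltr01.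
  rewrite !add0r rmorph1 rmorph0 mul1r mul0r => E; rewrite /Rintegral.
  under eq_integral do rewrite -[_%:C * z]add0r.
  by rewrite E // => t _; exists 1.
have Eone w : Re w = Re (1 * w) by rewrite mul1r.
have Ei w : Im w = Re (- 'i * w) by case: w => x y; simpc.
apply/eqP; rewrite eq_complex /=; apply/andP; split; apply/eqP.
  rewrite (_ : (fun t : R => Re (h (t%:C * z) * z)) = fun t : R => Re (1 * (h (t%:C * z) * z))).
    by rewrite E !mul1r ReB.
  by apply/funext => t; rewrite mul1r.
rewrite (_ : (fun t : R => Im (h (t%:C * z) * z)) = fun t : R => Re (- 'i * (h (t%:C * z) * z))).
  by rewrite E -!Ei ImB.
by apply/funext => t; rewrite Ei.
Qed.

(** Goursat's lemma in the plane yields a primitive of [h]; the fundamental theorem along [[0, z]]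
    identifies it with the Lebesgue integral [primitive0] up to a constant. *)
Lemma cd_primitive0 h : (forall z, exists l, cd setT h z l) ->
  forall z, cd setT (primitive0 h) z (h z).
Proof.
move=> dh z.
have cT : convex (@setT R[i]) by [].
have dH w : cd setT (line_int h 0) w (h w) by apply: (cd_line_int cT).
have ch w : ct setT h w by have [l /cd_ct] := dh w.
have hp w : cd setT (fun z => line_int h 0 z - line_int h 0 0) w (h w).
  by rewrite -[h w]subr0; apply: cdB; [exact: dH|exact: cd_cst].
apply: (cd_ext ltr01 _ _ (hp z)); first by rewrite (primitive0E _ dH ch).
by move=> w _ _; rewrite (primitive0E _ dH ch).
Qed.

Lemma primitive00 h : primitive0 h 0 = 0.
Proof.
rewrite /primitive0 /cintegral /Rintegral.
under eq_integral do rewrite mulr0 /=.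
under [X in _ +i* fine X]eq_integral do rewrite mulr0 /=.
by rewrite integral0.
Qed.

End Primitive0.

Section LocalInverse.
Variables (R : realType) (g dg : R[i] -> R[i]).
Hypothesis cd_g : forall w, cd setT g w (dg w).
Hypothesis ct_dg : forall w, ct setT dg w.
Hypothesis dg_neq0 : forall w, dg w != 0.
Implicit Types (D : set R[i]) (w z a : R[i]).

(** Continuity of [dg] at [a] and the mean value inequality on [[w', w]] make the linear
    approximation uniform in both points. The constant [cmod (dg a) / 2] is small enough for both
    injectivity and contraction. *)
Lemma strictly_differentiable a : exists2 d : R, 0 < d & forall w w',
  cmod (w - a) < d -> cmod (w' - a) < d ->
  cmod (g w - g w' - dg a * (w - w')) <= cmod (dg a) / 2 * cmod (w - w').
Proof.
have c0 : 0 < cmod (dg a) / 2 by rewrite divr_gt0 // cmod_gt0.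
have [d d0 hd] := ct_dg a c0; exists d => // w w' wa w'a.
apply: (@mean_value_sub _ g dg) => z sz; first by apply: cd_sub (cd_g z).
apply: ltW; apply: hd => //; move: sz => [t /andP[t0 t1] ->].
have -> : w' + t%:C * (w - w') - a = t%:C * (w - a) + (1 - t)%:C * (w' - a).
  by rewrite rmorphB rmorph1; ring.
apply: le_lt_trans (cmodD _ _) _; rewrite !cmodM !cmod_real !ger0_norm ?subr_ge0 //.
have [->|nt] := eqVneq t 0; first by rewrite mul0r add0r subr0 mul1r.
have t0' : 0 < t by rewrite lt_def nt.
nra.
Qed.

Lemma locally_expanding a : exists2 d : R, 0 < d & forall w w',
  cmod (w - a) < d -> cmod (w' - a) < d ->
  cmod (dg a) / 2 * cmod (w - w') <= cmod (g w - g w').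
Proof.
have [d d0 hd] := strictly_differentiable a; exists d => // w w' wa w'a.
have := hd w w' wa w'a; set y := g w - g w'; set x := w - w'.
have := cmodD y (dg a * x - y); rewrite addrC subrK cmodM.
rewrite [cmod (_ - y)]cmodB; lra.
Qed.

(** The radius [e] is left free below [d] so that it can be matched with the radius of
    [locally_expanding]. *)
Lemma locally_onto a : exists2 d : R, 0 < d & forall e y, 0 < e -> e <= d ->
  cmod (y - g a) < cmod (dg a) * e / 4 ->
  exists2 w, cmod (w - a) < e & g w = y.
Proof.
have [d d0 hd] := strictly_differentiable a; exists d => // e y e0 ed ya.
set c := dg a in hd ya *; have c0 : 0 < cmod c by rewrite cmod_gt0; exact: dg_neq0.
(* Newton's iteration with the derivative frozen at a *)
pose u := fix u n := if n is m.+1 then u m - (g (u m) - y) / c else a.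
pose s := cmod (y - g a) / cmod c.
have s0 : 0 <= s by rewrite divr_ge0 // cmod_ge0.
have se : s < e / 4 by rewrite /s ltr_pdivrMr //; lra.
have pos n : 0 < 2 ^+ n :> R by rewrite exprn_gt0.
have uS n : u n.+1 - u n = - (g (u n) - y) / c.
  by rewrite /= -/(u n); ring.
(* Strict differentiability makes each step at most half the bound on the previous one; the second
   part keeps the iterates within [2 * s < e / 2] of [a], where that estimate holds. *)
have H n : cmod (u n.+1 - u n) <= s / 2 ^+ n /\ cmod (u n - a) <= 2 * s - 2 * s / 2 ^+ n.
  elim: n => [|n [IH1 IH2]].
    rewrite uS expr0 !divr1 /= !subrr cmod0; split => //.
    by rewrite cmodM cmodV cmodN cmodB.
  have e1 : 2 * s / 2 ^+ n.+1 = s / 2 ^+ n.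
    by rewrite exprS; field; rewrite gt_eqF.
  have e2 : 2 * s / 2 ^+ n = s / 2 ^+ n + s / 2 ^+ n by ring.
  have sn : 0 <= s / 2 ^+ n by rewrite divr_ge0 // ltW.
  have h2 : cmod (u n.+1 - a) <= 2 * s - 2 * s / 2 ^+ n.+1.
    by apply: le_trans (cmod_tri _ (u n) _) _; lra.
  split => //.
  have -> : u n.+2 - u n.+1 = - (g (u n.+1) - g (u n) - c * (u n.+1 - u n)) / c.
    rewrite uS [in RHS]uS; field; by rewrite -cmod_gt0.
  rewrite cmodM cmodV cmodN ler_pdivrMr //.
  apply: le_trans (hd _ _ _ _) _; [lra|lra|].
  have -> : s / 2 ^+ n.+1 * cmod c = cmod c / 2 * (s / 2 ^+ n).
    by rewrite exprS; field; rewrite gt_eqF.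
  by rewrite ler_wpM2l // divr_ge0 // ltW.
have [l hl] := @geometric_cvgC _ u s (fun n => (H n).1).
have la : cmod (l - a) <= 2 * s by have := hl 0%N; rewrite /= cmodB expr0 divr1.
exists l; first by lra.
apply/eqP; rewrite -subr_eq0 -cmod_eq0 eq_le cmod_ge0 andbT.
apply/ler_addgt0Pr => t t0; rewrite add0r.
have [n hn] : exists n, 4 * cmod c * s / t < n%:R.
  by exists (Num.truncn (4 * cmod c * s / t)).+1; exact: truncnS_gt.
have n2 : 4 * cmod c * s / 2 ^+ n <= t.
  rewrite ler_pdivrMr // [t * _]mulrC; rewrite ltr_pdivrMr // in hn.
  apply: le_trans (ltW hn) _; rewrite ler_wpM2r ?(ltW t0) //.
  by rewrite -natrX ler_nat ltnW // ltn_expl.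
apply: le_trans n2.
have sn : 0 <= s / 2 ^+ n by rewrite divr_ge0 // ltW.
have [h1 h2] := H n.
have una : cmod (u n - a) < d.
  have e2 : 2 * s / 2 ^+ n = s / 2 ^+ n + s / 2 ^+ n by ring.
  lra.
have h3 := hd l (u n) ltac:(lra) una.
have h4 := hl n.
have h5 : cmod (g (u n) - y) = cmod c * cmod (u n.+1 - u n).
  by rewrite uS cmodM cmodN cmodV; field; lra.
(* The residual at the limit is split through [u n] into three terms of order [s / 2 ^+ n]. *)
have -> : g l - y = (g l - g (u n) - c * (l - u n)) + c * (l - u n) + (g (u n) - y).
  by ring.
apply: le_trans (cmodD _ _) _.
have := cmodD (g l - g (u n) - c * (l - u n)) (c * (l - u n)).
rewrite cmodM h5.
have h6 : cmod c * cmod (u n.+1 - u n) <= cmod c * (s / 2 ^+ n) by rewrite ler_wpM2l // ltW.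
have h7 : cmod c * cmod (l - u n) <= cmod c * (2 * (s / 2 ^+ n)).
  by rewrite ler_wpM2l ?(ltW c0) // cmodB mulrA.
have -> : 4 * cmod c * s / 2 ^+ n = 4 * (cmod c * (s / 2 ^+ n)) by ring.
have e8 : cmod c * (2 * (s / 2 ^+ n)) = 2 * (cmod c * (s / 2 ^+ n)) by ring.
have e9 : cmod c / 2 * cmod (l - u n) = (cmod c * cmod (l - u n)) / 2 by ring.
lra.
Qed.

(** The difference quotient of [f] is that of [h] times that of [g] at [h z]; the latter tends to
    [dg (h z)], which is nonzero, and can be divided out. *)
Lemma cd_lift D f h z l : D z -> ct D h z -> (forall w, D w -> g (h w) = f w) ->
  cd D f z l -> cd D h z (l / dg (h z)).
Proof.
move=> Dz ch gh /cd_ctP[p [cp pz hp]].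
have /cd_ctP[q [cq qz hq]] := cd_g (h z).
have q0 : q (h z) != 0 by rewrite qz.
have cqh : ct D (fun w => q (h w)) z by apply: ct_comp ch cq.
have [|d d0 hd] := cqh (cmod (q (h z))); first by rewrite cmod_gt0.
apply: (@cd_near _ (D `&` [set w | q (h w) != 0]) _ _ _ _ d) => //.
  move=> w wz Dw; split => //=; apply: contraTneq (hd w Dw wz) => ->.
  by rewrite sub0r cmodN ltxx.
have sD : D `&` [set w | q (h w) != 0] `<=` D by move=> w [].
apply/cd_ctP; exists (fun w => p w * (q (h w))^-1); split.
- by apply: ctM; [exact: ct_sub cp|apply: ctV => //; exact: ct_sub cqh].
- by rewrite pz qz.
- move=> w [Dw /= qw]; have := hq (h w) I; rewrite !gh // hp // => e.
  by apply: (mulfI qw); rewrite -e; field.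
Qed.

(** Along a segment, the parameters at which the lifts agree form an open set since [g] is locally
    injective, and those at which they differ form an open set by continuity. *)
Lemma unique_lift D h1 h2 a b : convex D ->
  (forall w, D w -> ct D h1 w) -> (forall w, D w -> ct D h2 w) ->
  (forall w, D w -> g (h1 w) = g (h2 w)) ->
  D a -> D b -> h1 a = h2 a -> h1 b = h2 b.
Proof.
move=> cD c1 c2 gh Da Db ab.
pose p (t : R) := a + t%:C * (b - a).
have pB s t : p s - p t = (s - t)%:C * (b - a).
  by rewrite /p rmorphB; ring.
have p0 : p 0 = a by rewrite /p mul0r addr0.
have p1 : p 1 = b by rewrite /p mul1r addrC subrK.
have [] // := @locally_constant_itv _ 0 1 (fun t => h1 (p t) = h2 (p t)) ler01; last first.
  by rewrite p0 p1; auto.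
have Dp t : 0 <= t <= 1 -> D (p t) by move=> /andP[? ?]; apply: (cD _ _ Da Db); exact: seg_pt.
have b1 : 0 < cmod (b - a) + 1 by have := cmod_ge0 (b - a); lra.
have near e t : 0 < e -> 0 <= t <= 1 -> exists2 d : R, 0 < d & forall s, 0 <= s <= 1 ->
    `|s - t| < d -> cmod (h1 (p s) - h1 (p t)) < e /\ cmod (h2 (p s) - h2 (p t)) < e.
  move=> e0 t01; have Dt := Dp t t01.
  have [d d0 hd] := c1 _ Dt e e0; have [d' d'0 hd'] := c2 _ Dt e e0.
  exists (Num.min d d' / (cmod (b - a) + 1)); first by rewrite divr_gt0 // lt_min d0.
  move=> s s01; rewrite ltr_pdivlMr // => st.
  have : cmod (p s - p t) < Num.min d d'.
    rewrite pB cmodM cmod_real; apply: le_lt_trans st; rewrite ler_wpM2l //; lra.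
  by rewrite lt_min => /andP[? ?]; split; [apply: hd|apply: hd'] => //; exact: Dp.
move=> t t01; have [eqt|net] := pselect (h1 (p t) = h2 (p t)).
  have [e e0 he] := locally_expanding (h1 (p t)).
  have [d d0 hd] := near e t e0 t01; exists d => // s s01 /(hd s s01)[k1 k2].
  split => // _; rewrite -eqt in k2.
  apply/eqP; rewrite -subr_eq0 -cmod_eq0 eq_le cmod_ge0 andbT.
  have := he _ _ k1 k2; rewrite gh ?subrr ?cmod0; last exact: Dp.
  by rewrite pmulr_rle0 // divr_gt0 // cmod_gt0.
have e0 : 0 < cmod (h1 (p t) - h2 (p t)) / 2.
  by rewrite divr_gt0 // cmod_gt0 subr_eq0; apply/eqP.
have [d d0 hd] := near _ t e0 t01; exists d => // s s01 /(hd s s01)[k1 k2].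
split => // eqs; exfalso; rewrite -eqs in k2.
have := cmod_tri (h1 (p t)) (h1 (p s)) (h2 (p t)); rewrite [cmod (h1 (p t) - h1 _)]cmodB; lra.
Qed.

End LocalInverse.

(** * Boundary behaviour and continuation *)

Section Boundary.
Variables (R : realType) (f g dg L : R[i] -> R[i]) (r : R).
Hypothesis cd_g : forall w, cd setT g w (dg w).
Hypothesis ct_dg : forall w, ct setT dg w.
Hypothesis dg_neq0 : forall w, dg w != 0.
Hypothesis diff_f : forall z, exists l, cd setT f z l.
Hypothesis diff_L : forall z, cmod z < r -> exists l, cd setT L z l.
Hypothesis gL : forall z, cmod z < r -> g (L z) = f z.
Implicit Types (a b z w : R[i]).

Let ct_f z : ct setT f z.
Proof. by have [l /cd_ct] := diff_f z. Qed.

Let ct_g w : ct setT g w.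
Proof. exact: cd_ct (cd_g w). Qed.

Let ct_L z : cmod z < r -> ct setT L z.
Proof. by move=> /diff_L[l /cd_ct]. Qed.

Lemma inv_small (d : R) : 0 < d -> exists n, n.+1%:R^-1 < d.
Proof.
move=> d0; exists (Num.truncn d^-1).
by rewrite invf_plt ?posrE // truncnS_gt.
Qed.

Lemma inv_small_le (d : R) m n : m.+1%:R^-1 < d -> (m <= n)%N -> n.+1%:R^-1 < d.
Proof.
move=> h mn; apply: le_lt_trans h.
by rewrite lef_pV2 ?posrE // ler_nat.
Qed.

Lemma convex_ball a (e : R) : convex [set z | cmod (z - a) < e].
Proof.
move=> x y /= xa ya _ [t /andP[t0 t1] ->] /=.
have -> : x + t%:C * (y - x) - a = t%:C * (y - a) + (1 - t)%:C * (x - a).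
  by rewrite rmorphB rmorph1; ring.
apply: le_lt_trans (cmodD _ _) _; rewrite !cmodM !cmod_real !ger0_norm ?subr_ge0 //.
have [->|nt] := eqVneq t 0; first by rewrite mul0r add0r subr0 mul1r.
have t0' : 0 < t by rewrite lt_def nt.
nra.
Qed.

Lemma convexI (D E : set R[i]) : convex D -> convex E -> convex (D `&` E).
Proof. by move=> cD cE x y [Dx Ex] [Dy Ey] z sz; split; [apply: cD sz|apply: cE sz]. Qed.

Definition cluster_value a w := forall d e : R, 0 < d -> 0 < e ->
  exists z, [/\ cmod z < r, cmod (z - a) < d & cmod (L z - w) < e].

Definition limit_value a w := forall e : R, 0 < e -> exists2 d : R, 0 < d &
  forall z, cmod z < r -> cmod (z - a) < d -> cmod (L z - w) < e.

(** This holds vacuously for [cmod a > r], so the blow-up set is formed together with the condition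
    [cmod a = r]. *)
Definition blow_up a := forall M : R, exists2 d : R, 0 < d &
  forall z, cmod z < r -> cmod (z - a) < d -> M < cmod (L z).

Lemma cluster_value_eq a w : cluster_value a w -> g w = f a.
Proof.
move=> cl; apply/eqP; rewrite -subr_eq0 -cmod_eq0 eq_le cmod_ge0 andbT.
apply/ler_addgt0Pr => e e0; rewrite add0r; have e2 : 0 < e / 2 by lra.
have [d d0 hd] := ct_f a e2; have [d' d'0 hd'] := ct_g w e2.
have [z [zr za zw]] := cl d d' d0 d'0.
have := hd z I za; have := hd' (L z) I zw; rewrite gL // => h1 h2.
by apply: le_trans (cmod_tri _ (f z) _) _; rewrite cmodB; lra.
Qed.

(* L maps a small convex piece of the disk near a into the complement of
   small circles around w: on such a circle g is away from g w = f a. *)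
Lemma cluster_limit a w : cluster_value a w -> limit_value a w.
Proof.
move=> cl e e0; have gw := cluster_value_eq cl.
have [d0 d00 hexp] := locally_expanding cd_g ct_dg dg_neq0 w.
(* [e' < d0] keeps the circle of radius [e'] around [w] inside the ball where [g] is expanding. *)
pose e' := Num.min e (d0 / 2).
have e'0 : 0 < e' by rewrite lt_min e0 /=; lra.
have e'e : e' <= e by rewrite ge_min lexx.
have e'2 : e' <= d0 / 2 by rewrite ge_min lexx orbT.
have e'd : e' < d0 by lra.
have c0 : 0 < cmod (dg w) / 2 by rewrite divr_gt0 // cmod_gt0.
(* On that circle [g] is at least [cmod (dg w) / 2 * e'] away from [g w = f a]; this [d] keeps [f]
   strictly closer. *)
have [d d'0 hd] := ct_f a (mulr_gt0 c0 e'0).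
exists d => // z zr za.
have [y [yr ya yw]] := cl d e' d'0 e'0.
suff : cmod (L z - w) < e' by move/lt_le_trans; apply.
pose p (t : R) := y + t%:C * (z - y).
have p0 : p 0 = y by rewrite /p mul0r addr0.
have p1 : p 1 = z by rewrite /p mul1r addrC subrK.
have pB s t : p s - p t = (s - t)%:C * (z - y) by rewrite /p rmorphB; ring.
have pr t : 0 <= t <= 1 -> cmod (p t) < r /\ cmod (p t - a) < d.
  move=> /andP[t0 t1]; split; last by apply: (convex_ball ya za); exact: seg_pt.
  have := @convex_ball 0 r y z; rewrite /= !subr0 => /(_ yr zr (p t)).
  by rewrite /= subr0; apply; exact: seg_pt.
have never t : 0 <= t <= 1 -> cmod (L (p t) - w) != e'.
  move=> /pr[h1 h2]; apply/eqP => h3.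
  have := hexp (L (p t)) w; rewrite h3 subrr cmod0 gL // gw => /(_ e'd d00).
  have := hd (p t) I h2; lra.
have [|h _] := @locally_constant_itv _ 0 1 (fun t => cmod (L (p t) - w) < e') ler01; last first.
  by move: h; rewrite p0 p1; apply.
move=> t t01; have [ptr _] := pr t t01; have nv := never t t01.
(* The tolerance is the gap between [cmod (L (p t) - w)] and [e'], so the comparison with [e']
   cannot change nearby. *)
have [|k k0 hk] := ct_L ptr (e := `|cmod (L (p t) - w) - e'|).
  by rewrite normr_gt0 subr_eq0.
have b1 : 0 < cmod (z - y) + 1 by have := cmod_ge0 (z - y); lra.
exists (k / (cmod (z - y) + 1)); first by rewrite divr_gt0.
move=> s s01; rewrite ltr_pdivlMr // => st.
have : cmod (p s - p t) < k.
  rewrite pB cmodM cmod_real; apply: le_lt_trans st; rewrite ler_wpM2l //; lra.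
move=> /(hk _ I); set A := cmod (L (p t) - w) in nv *.
have := cmod_tri (L (p s)) (L (p t)) w; have := cmod_tri (L (p t)) (L (p s)) w.
rewrite -/A [cmod (L (p t) - L (p s))]cmodB => h1 h2.
case: (ltrP A e') => h3.
  by move=> h4; split => // _; lra.
by move=> h4; split => // h5; lra.
Qed.

Lemma bounded_cluster a (u : nat -> R[i]) (M : R) :
  (forall n, cmod (u n) < r) -> (forall n, cmod (L (u n)) <= M) ->
  (forall d : R, 0 < d -> exists N, forall n, (N <= n)%N -> cmod (u n - a) < d) ->
  exists w, cluster_value a w.
Proof.
move=> ur uM ua; have [w hw] := bolzano_weierstrassC uM.
exists w => d e d0 e0; have [N hN] := ua d d0.
by have [n nN hn] := hw e N e0; exists (u n); split => //; exact: hN.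
Qed.

(** If [L] does not blow up, it is bounded along some sequence tending to [a] and so has a cluster
    value there, which is automatically a limit. *)
Lemma blow_up_or_limit a : blow_up a \/
  exists w, cluster_value a w /\ limit_value a w.
Proof.
have [|nb] := pselect (blow_up a); [by left|right].
have [M hM] : exists M : R, forall d : R, 0 < d ->
    exists z, [/\ cmod z < r, cmod (z - a) < d & cmod (L z) <= M].
  apply: contrapT => /forallNP no; apply: nb => M.
  apply: contrapT => no2; apply: (no M) => d d0; apply: contrapT => no3.
  apply: no2; exists d => // z zr za; rewrite ltNge; apply/negP => h.
  by apply: no3; exists z.
have [u hu] : {u & forall n : nat,
    [/\ cmod (u n) < r, cmod (u n - a) < n.+1%:R^-1 & cmod (L (u n)) <= M]}.
  apply: (@choice _ _ (fun (n : nat) z =>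
    [/\ cmod z < r, cmod (z - a) < n.+1%:R^-1 & cmod (L z) <= M])).
  by move=> n; apply: hM; rewrite invr_gt0.
have [w cw] : exists w, cluster_value a w.
  apply: (@bounded_cluster a u M) => [n|n|d d0]; try by have [] := hu n.
  have [N hN] := inv_small d0; exists N => n Nn.
  by have [_ h _] := hu n; apply: lt_trans h (inv_small_le hN Nn).
by exists w; split => //; exact: cluster_limit.
Qed.

Lemma radial_point a (d : R) : 0 < r -> cmod a = r -> 0 < d ->
  exists2 z, cmod z < r & cmod (z - a) < d.
Proof.
move=> r0 ar d0; pose s := Num.min (1 / 2) (d / (2 * r)).
have s0 : 0 < s by rewrite lt_min divr_gt0 //= divr_gt0 // mulr_gt0.
have s1 : s <= 1 / 2 by rewrite ge_min lexx.
have s2 : s * (2 * r) <= d by rewrite -ler_pdivlMr ?mulr_gt0 // ge_min lexx orbT.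
exists ((1 - s)%:C * a).
  by rewrite cmodM cmod_real ger0_norm ?ar; [nra|lra].
have -> : (1 - s)%:C * a - a = (- s)%:C * a by rewrite rmorphB rmorphN rmorph1; ring.
by rewrite cmodM cmod_real normrN ger0_norm ?ar; [nra|lra].
Qed.

(** A finite limit at [a] would bound [L] on a neighbourhood of [a] in the disk, which also meets
    every neighbourhood of a nearby blow-up point. *)
Lemma blow_up_closed a : 0 < r -> cmod a = r ->
  (forall e : R, 0 < e -> exists b, [/\ cmod b = r, blow_up b & cmod (b - a) < e]) ->
  blow_up a.
Proof.
move=> r0 ar H; have [//|[w [_ lim]]] := blow_up_or_limit a.
have [d d0 hd] := lim 1 ltr01; have d2 : 0 < d / 2 by lra.
have [b [br bb ba]] := H _ d2.
have [d' d'0 hd'] := bb (cmod w + 1).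
have [|z zr zb] := @radial_point b (Num.min d' (d / 2)) r0 br.
  by rewrite lt_min d'0.
move: zb; rewrite lt_min => /andP[/(hd' z zr) h zb].
have : cmod (z - a) < d by apply: le_lt_trans (cmod_tri _ b _) _; lra.
move=> /(hd z zr) h'; exfalso.
by have := cmodD w (L z - w); rewrite addrC subrK; lra.
Qed.

Lemma bounded_seq_cvg a (u : nat -> R[i]) (M : R) :
  (forall n, cmod (u n) < r) -> (forall n, cmod (L (u n)) <= M) ->
  (forall d : R, 0 < d -> exists N, forall n, (N <= n)%N -> cmod (u n - a) < d) ->
  exists w, forall e : R, 0 < e ->
    exists N, forall n, (N <= n)%N -> cmod (L (u n) - w) < e.
Proof.
move=> ur uM ua; have [w /cluster_limit hw] := bounded_cluster ur uM ua.
exists w => e /hw[d d0 hd]; have [N hN] := ua d d0.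
by exists N => n /hN; exact: hd.
Qed.

(** The lift is only asked to be continuous; [cd_lift] supplies its differentiability. *)
Definition extension a (e : R) (h : R[i] -> R[i]) :=
  [/\ forall z, cmod (z - a) < e -> g (h z) = f z,
      forall z, cmod (z - a) < e -> ct [set z | cmod (z - a) < e] h z
    & forall z, cmod z < r -> cmod (z - a) < e -> h z = L z].

(** [locally_onto] provides a preimage of [f z] near [w]; [locally_expanding] makes it unique there,
    hence equal to [L z] inside the disk and continuous in [z]. *)
Lemma cluster_extension a w : cluster_value a w ->
  exists e h, 0 < e /\ extension a e h.
Proof.
move=> cl; have gw := cluster_value_eq cl; have lim := cluster_limit cl.
have [d1 d10 hexp] := locally_expanding cd_g ct_dg dg_neq0 w.
have [d2 d20 honto] := locally_onto cd_g ct_dg dg_neq0 w.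
pose d := Num.min d1 d2.
have d0 : 0 < d by rewrite lt_min d10.
have dd1 : d <= d1 by rewrite ge_min lexx.
have dd2 : d <= d2 by rewrite ge_min lexx orbT.
have c0 : 0 < cmod (dg w) by rewrite cmod_gt0.
have [|e1 e10 he1] := ct_f a (e := cmod (dg w) * d / 4).
  by rewrite divr_gt0 // mulr_gt0.
have [e2 e20 he2] := lim d d0.
pose e := Num.min e1 e2.
have e0 : 0 < e by rewrite lt_min e10.
have [h hh] : {h & forall z, cmod (z - a) < e -> cmod (h z - w) < d /\ g (h z) = f z}.
  apply: (@choice _ _ (fun z y => cmod (z - a) < e -> cmod (y - w) < d /\ g y = f z)).
  move=> z; have [|nz] := pselect (cmod (z - a) < e); last by exists 0 => /nz.
  rewrite lt_min => /andP[za _].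
  have [|y hy1 hy2] := honto d (f z) d0 dd2; first by rewrite gw; exact: he1.
  by exists y.
exists e, h; split => //; split.
- by move=> z /hh[].
- move=> z za k k0.
  have [|m m0 hm] := ct_f z (e := cmod (dg w) / 2 * k).
    by rewrite mulr_gt0 // divr_gt0.
  exists m => // y ya yz.
  have [h1 h2] := hh z za; have [h3 h4] := hh y ya.
  have := hexp (h y) (h z) (lt_le_trans h3 dd1) (lt_le_trans h1 dd1).
  rewrite h2 h4 => /le_lt_trans /(_ (hm y I yz)).
  by rewrite ltr_pM2l // divr_gt0.
- move=> z zr za; have [h1 h2] := hh z za.
  apply/eqP; rewrite -subr_eq0 -cmod_eq0 eq_le cmod_ge0 andbT.
  have h3 : cmod (L z - w) < d.
    by apply: he2 => //; move: za; rewrite lt_min => /andP[].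
  have := hexp (h z) (L z) (lt_le_trans h1 dd1) (lt_le_trans h3 dd1).
  by rewrite h2 gL // subrr cmod0 pmulr_rle0 // divr_gt0.
Qed.

Lemma extension_sub a b (e e' : R) h : cmod (b - a) + e' <= e ->
  extension a e h -> extension b e' h.
Proof.
move=> be [h1 h2 h3].
have sub z : cmod (z - b) < e' -> cmod (z - a) < e.
  by move=> zb; apply: le_lt_trans (cmod_tri _ b _) _; lra.
split.
- by move=> z /sub/h1.
- by move=> z /sub/h2; apply: ct_sub => y /sub.
- by move=> z zr /sub; exact: h3.
Qed.

Lemma extension_cd a (e : R) h z : extension a e h -> cmod (z - a) < e ->
  exists l, cd setT h z l.
Proof.
move=> [h1 h2 h3] za; have [l hl] := diff_f z.
exists (l / dg (h z)).
apply: (@cd_near _ [set y | cmod (y - a) < e] _ _ _ _ (e - cmod (z - a))).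
- by rewrite subr_gt0.
- move=> y yz _ /=; apply: le_lt_trans (cmod_tri _ z _) _; lra.
- by apply: (cd_lift cd_g dg_neq0 (f := f)) => //; [exact: h2|exact: cd_sub hl].
Qed.

Hypothesis r_gt0 : 0 < r.

(** Strict convexity of the disk, by the parallelogram law. *)
Lemma cmod_midpoint a b : cmod a = r -> cmod b = r -> a != b ->
  cmod (1 / 2 * (a + b)) < r.
Proof.
move=> ar br ab.
have e : cmod (a + b) ^+ 2 + cmod (a - b) ^+ 2 = 4 * r ^+ 2.
  have -> : 4 * r ^+ 2 = 2 * cmod a ^+ 2 + 2 * cmod b ^+ 2 by rewrite ar br; ring.
  rewrite !cmod_sqrt !sqr_sqrtr ?addr_ge0 ?sqr_ge0 // !ReD !ImD.
  by case: (a) => ? ?; case: (b) => ? ? /=; ring.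
have ab0 : 0 < cmod (a - b) ^+ 2 by rewrite exprn_gt0 // cmod_gt0 subr_eq0.
suff : cmod (a + b) < 2 * r by rewrite cmod_half; lra.
rewrite -ltr_sqr ?nnegrE ?cmod_ge0 ?mulr_ge0 ?(ltW r_gt0) //.
have -> : (2 * r) ^+ 2 = 4 * r ^+ 2 by ring.
lra.
Qed.

(** Two overlapping disks of equal radius contain the midpoint of their centres. It lies in the open
    disk, where both lifts equal [L], and uniqueness of lifts spreads the equality over the convex
    intersection. *)
Lemma extension_eq a b (e : R) h k z : cmod a = r -> cmod b = r ->
  extension a e h -> extension b e k ->
  cmod (z - a) < e -> cmod (z - b) < e -> a != b -> h z = k z.
Proof.
move=> ar br [h1 h2 h3] [k1 k2 k3] za zb ab.
pose D := [set z | cmod (z - a) < e] `&` [set z | cmod (z - b) < e].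
pose m := 1 / 2 * (a + b).
have mr : cmod m < r by exact: cmod_midpoint.
have abe : cmod (a - b) < 2 * e.
  by have := cmod_tri a z b; rewrite [cmod (a - z)]cmodB; lra.
have ma : cmod (m - a) < e.
  have -> : m - a = 1 / 2 * (b - a) by rewrite /m; field.
  rewrite cmod_half [cmod (b - a)]cmodB; lra.
have mb : cmod (m - b) < e.
  have -> : m - b = 1 / 2 * (a - b) by rewrite /m; field.
  rewrite cmod_half; lra.
apply: (unique_lift cd_g ct_dg dg_neq0 (D := D) (a := m)) => //.
- by apply: convexI; exact: convex_ball.
- by move=> w [wa wb]; apply: ct_sub (h2 w wa) => y [].
- by move=> w [wa wb]; apply: ct_sub (k2 w wb) => y [].
- by move=> w [wa wb]; rewrite h1 // k1.
- by rewrite h3 // k3.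
Qed.

(** A Lebesgue number: centres without an extension of radius [1 / (n + 1)] would accumulate at a
    point of the circle, whose own extension covers one of these small disks. *)
Lemma uniform_extension :
  (forall a, cmod a = r -> exists e h, 0 < e /\ extension a e h) ->
  exists2 e : R, 0 < e & forall a, cmod a = r -> exists h, extension a e h.
Proof.
move=> ext; apply: contrapT => no.
have [u hu] : {u : nat -> R[i] & forall n : nat, cmod (u n) = r /\
    ~ exists h, extension (u n) (n.+1%:R^-1) h}.
  apply: (@choice _ _ (fun n a => cmod a = r /\ ~ exists h, extension a (n.+1%:R^-1) h)).
  move=> n; apply: contrapT => /forallNP no2; apply: no.
  exists n.+1%:R^-1 => // a ar; apply: contrapT => no3.
  by apply: (no2 a).
have [l hl] : exists l, forall (e : R) N, 0 < e ->
    exists2 n, (N <= n)%N & cmod (u n - l) < e.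
  by apply: (@bolzano_weierstrassC _ u r) => n; have [->] := hu n.
have lr : cmod l = r.
  apply/eqP; rewrite -subr_eq0 -normr_eq0 eq_le normr_ge0 andbT.
  apply/ler_addgt0Pr => e e0; have [n _ hn] := hl e 0%N e0; rewrite add0r.
  have [ur _] := hu n.
  have := cmodD l (u n - l); have := cmodD (u n) (l - u n).
  rewrite ![_ + (_ - _)]addrC !subrK ur [cmod (l - _)]cmodB => h1 h2.
  by rewrite ler_norml; lra.
have [e [h [e0 hext]]] := ext l lr.
have e2 : 0 < e / 2 by lra.
have [N hN] := inv_small e2; have [n Nn hn] := hl _ N e2.
have [_] := hu n; apply; exists h; apply: extension_sub hext.
have := inv_small_le hN Nn; move: (_.+1%:R^-1) => q; lra.
Qed.

Lemma global_extension :
  (forall a, cmod a = r -> exists e h, 0 < e /\ extension a e h) ->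
  exists2 e : R, 0 < e & exists2 H, forall z, cmod z < r + e -> exists l, cd setT H z l
    & forall z, cmod z < r -> H z = L z.
Proof.
move=> /uniform_extension[e e0 ext]; exists e => //.
have [h hh] : {h & forall a, cmod a = r -> extension a e (h a)}.
  apply: (@choice _ _ (fun a k => cmod a = r -> extension a e k)) => a.
  by have [/ext[k hk]|nr] := pselect (cmod a = r); [exists k|exists id => /nr].
(* Outside the disk, the radial projection onto the circle selects the extension to use at [z]. *)
pose rad z := (r / cmod z)%:C * z.
pose H z := if cmod z < r then L z else h (rad z) z.
have radr z : r <= cmod z -> cmod (rad z) = r /\ cmod (z - rad z) = cmod z - r.
  move=> rz; have z0 : 0 < cmod z by exact: lt_le_trans rz.
  have rz0 : 0 <= r / cmod z by rewrite divr_ge0 // ltW.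
  split.
    by rewrite cmodM cmod_real ger0_norm // divfK // gt_eqF.
  have -> : z - rad z = (1 - r / cmod z)%:C * z by rewrite /rad rmorphB rmorph1; ring.
  rewrite cmodM cmod_real ger0_norm; first by field; rewrite gt_eqF.
  by rewrite subr_ge0 ler_pdivrMr // mul1r.
(* Near a given point [H] coincides with a single [h a], although the projection varies; this makes
   [H] differentiable. *)
have HE a z : cmod a = r -> cmod (z - a) < e -> cmod z < r + e -> H z = h a z.
  move=> ar za zr; rewrite /H; case: ltrP => rz.
    by have [_ _ ->] := hh a ar.
  have [h1 h2] := radr z rz.
  have [->//|ne] := eqVneq (rad z) a.
  apply: (extension_eq h1 ar (hh _ h1) (hh a ar)) => //; lra.
exists H; last by move=> z zr; rewrite /H zr.
move=> z zr; have [zr'|rz] := ltrP (cmod z) r.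
  have [l hl] := diff_L zr'; exists l.
  apply: (cd_ext (r := r - cmod z) _ _ _ hl); rewrite ?subr_gt0 //.
    by rewrite /H zr'.
  move=> w _ wz; rewrite /H; have -> // : cmod w < r.
  by have := cmodD z (w - z); rewrite addrC subrK; lra.
have [h1 h2] := radr z rz.
have za : cmod (z - rad z) < e by lra.
have [l hl] := extension_cd (hh _ h1) za; exists l.
apply: (cd_ext (r := r + e - cmod z) _ _ _ hl); rewrite ?subr_gt0 //.
  by rewrite (HE (rad z)).
move=> w _ wz; rewrite (HE (rad z)) //.
  by apply: le_lt_trans (cmod_tri _ z _) _; lra.
by have := cmodD z (w - z); rewrite addrC subrK; lra.
Qed.

End Boundary.

(** * Blow-up points form a null set *)

Section Ccos.
Variable R : realType.
Implicit Types (z w : R[i]).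

Lemma cd_cexp z : cd setT (@cexp R) z (cexp z).
Proof.
have h1 : cd setT (fun w => w - z) z (1 - 0).
  by apply: cdB; [exact: cd_id|exact: cd_cst].
have h2 : cd setT (fun w => cexp (w - z)) z (1 * (1 - 0)).
  have h0 : cd setT (@cexp R) (z - z) 1 by rewrite subrr; exact: cd_cexp0.
  exact: (cd_comp (E := setT) _ h1 h0).
have := cdMl (cexp z) h2; rewrite subr0 !mulr1.
apply: (@cd_ext _ _ _ _ _ _ 1) => //; first by rewrite subrr cexp0 mulr1.
by move=> w _ _; rewrite -cexpD addrC subrK.
Qed.

Lemma cd_cexp_comp D (f : R[i] -> R[i]) z l : cd D f z l ->
  cd D (fun w => cexp (f w)) z (cexp (f z) * l).
Proof. by move=> h; exact: (cd_comp (E := setT) _ h (cd_cexp (f z))). Qed.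

Definition ccos z : R[i] := 1 / 2 * (cexp ('i * z) + cexp (- ('i * z))).

Lemma cexp_im (t : R) : cexp (t *i) = cos t +i* sin t.
Proof. by rewrite /cexp /= expR0 mul1r. Qed.

Lemma cexpE (x y : R) : cexp (x +i* y) = (expR x)%:C * (cos y +i* sin y).
Proof. by []. Qed.

Lemma muliE z : 'i * z = (- Im z) +i* Re z.
Proof. by case: z => a b; simpc. Qed.

Lemma ccos_real (t : R) : ccos t%:C = (cos t)%:C.
Proof.
rewrite /ccos.
have -> : 'i * t%:C = t *i by simpc.
have -> : - (t *i) = (- t) *i :> R[i] by simpc.
rewrite !cexp_im cosN sinN.
have -> : 1 / 2 = (1 / 2)%:C :> R[i] by rewrite half_real.
by simpc; congr (_ +i* _); field.
Qed.

Lemma cd_ccos z : exists l, cd setT ccos z l.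
Proof.
have h : cd setT (fun z => 'i * z) z ('i * 1) by apply: cdMl; exact: cd_id.
eexists; apply: cdMl; apply: cdD; first exact: (cd_cexp_comp h).
exact: (cd_cexp_comp (cdN h)).
Qed.

Lemma cmod_ccos z : cmod (ccos z) <= expR `|Im z|.
Proof.
rewrite /ccos cmod_half; have := cmodD (cexp ('i * z)) (cexp (- ('i * z))).
rewrite !cmod_cexp muliE /=.
have : expR (- Im z) <= expR `|Im z| by rewrite ler_expR -normrN ler_norm.
have : expR (- - Im z) <= expR `|Im z| by rewrite ler_expR opprK ler_norm.
lra.
Qed.

(** The value is [- i sinh y]: purely imaginary on the line [Re z = pi / 2], and zero at [y = 0]. *)
Lemma ccos_pihalf (y : R) :
  ccos ((pi / 2) +i* y) = - 'i * ((expR y - expR (- y)) / 2)%:C.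
Proof.
rewrite /ccos.
have -> : 'i * ((pi / 2) +i* y) = (- y) +i* (pi / 2) by simpc.
have -> : - ((- y) +i* (pi / 2)) = y +i* (- (pi / 2)) :> R[i] by simpc.
rewrite !cexpE cosN sinN cos_pihalf sin_pihalf.
have -> : 1 / 2 = (1 / 2)%:C :> R[i] by rewrite half_real.
by simpc; congr (_ +i* _); field.
Qed.

Lemma ccosN z : ccos (- z) = ccos z.
Proof. by rewrite /ccos mulrN opprK addrC. Qed.

End Ccos.

Section NullSet.
Variable R : realType.
Notation mu := (@lebesgue_measure R).

(** Markov's inequality gives [N * mu E <= B] for every [N > 0]. *)
Lemma null_of_bounded_integrals (x y B : R) (E : set R) : measurable E ->
  E `<=` `[x, y] ->
  (forall N, 0 < N -> exists f : R -> R,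
    [/\ forall t, x <= t <= y -> {for t, continuous f},
        forall t, x <= t <= y -> 0 <= f t,
        forall t, E t -> N <= f t
      & (\int[mu]_(t in `[x, y]) (f t)%:E <= B%:E)%E]) ->
  mu E = 0.
Proof.
move=> mE Exy H.
have HN N : 0 < N -> (N%:E * mu E <= B%:E)%E.
  move=> N0; have [f [cf f0 fN fB]] := H N N0.
  have mf : measurable_fun `[x, y] f.
    apply: subspace_continuous_measurable_fun => //.
    apply/subspace_continuousP => t; rewrite /= in_itv /= => /cf h.
    exact: cvg_within_filter.
  rewrite -integral_cst //; apply: le_trans fB.
  apply: (@le_trans _ _ (\int[mu]_(t in E) (f t)%:E)%E).
    apply: ge0_le_integral => //.
    - by move=> t _; rewrite lee_fin ltW.
    - by apply/measurable_EFinP; apply: measurable_funS mf.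
  apply: ge0_subset_integral => //; first exact/measurable_EFinP.
have E0 : (0 <= mu E)%E by exact: measure_ge0.
have [muE|] := ltP (mu E) +oo%E; last first.
  by rewrite leye_eq => /eqP e; have := HN 1 ltr01; rewrite e mul1e leye_eq.
have fE : mu E \is a fin_num by rewrite ge0_fin_numE.
rewrite -(fineK fE) in HN E0 *; move: (fine _) HN E0 => m HN; rewrite lee_fin => m0.
congr (_%:E); apply/eqP; rewrite eq_le m0 andbT leNgt; apply/negP => mp.
have B0 : 0 <= B by have := HN 1 ltr01; rewrite mul1e lee_fin; lra.
have := HN ((B + 1) / m); rewrite divr_gt0 //; last lra.
by rewrite -EFinM lee_fin divfK ?gt_eqF // => /(_ isT); lra.
Qed.

End NullSet.

(** * Cauchy's theorem on a rectangle with a cosine weight *)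

Section Rectangle.
Variables (R : realType) (psi dpsi : R[i] -> R[i]) (t0 a a' b : R).
Notation mu := (@lebesgue_measure R).
Hypotheses (a_gt0 : 0 < a) (aa' : a < a') (b_gt0 : 0 < b).

(** Goursat's lemma asks for a closed convex set, while [psi] is controlled only above the real
    axis; hence closed rectangles of bottom height [y > 0]. The margin [a' - a] leaves room for
    two-sided real derivatives at [t0 - a] and [t0 + a]. *)
Definition rect (y : R) : set R[i] :=
  [set z | `|Re z - t0| <= a' /\ y <= Im z <= b].

Let Q : set R[i] := [set z | `|Re z - t0| <= a' /\ 0 < Im z <= b].

Hypothesis cd_psi : forall z, Q z -> cd Q psi z (dpsi z).
Hypothesis diff_dpsi : forall z, Q z -> exists l, cd Q dpsi z l.
Hypothesis psi_gt1 : forall z, Q z -> 1 < cmod (psi z).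

Let k : R := pi / 2 / a.

Lemma convex_rect y : convex (rect y).
Proof.
move=> u v [u1 /andP[u2 u3]] [v1 /andP[v2 v3]] _ [t /andP[t0' t1] ->].
rewrite /rect /= Re_seg Im_seg; move: u1 v1; rewrite !ler_norml => /andP[? ?] /andP[? ?].
by split; apply/andP; split; nra.
Qed.

Lemma closed_rect y (z : R[i]) :
  (forall e : R, 0 < e -> exists2 w, rect y w & cmod (w - z) < e) -> rect y z.
Proof.
move=> H; split; [|apply/andP; split]; apply/ler_addgt0Pr => e e0;
  have [w [w1 /andP[w2 w3]] wz] := H e e0;
  have := le_lt_trans (cmod_Re _) wz; have := le_lt_trans (cmod_Im _) wz;
  rewrite ReB ImB !ltr_norml => /andP[? ?] /andP[? ?]; try lra.
by move: w1; rewrite !ler_norml => /andP[? ?]; apply/andP; split; lra.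
Qed.

Let rectQ y : 0 < y -> rect y `<=` Q.
Proof. by move=> y0 z [h1 /andP[h2 h3]]; split => //; rewrite (lt_le_trans y0). Qed.

(** Integrating the logarithmic derivative yields a logarithm of [psi] without choosing branches. *)
Let p z := dpsi z * (psi z)^-1.
Let z0 : R[i] := t0 +i* b.

Let psi_neq0 z : Q z -> psi z != 0.
Proof. by move=> /psi_gt1 h; rewrite -cmod_gt0; lra. Qed.

Let rect_z0 y : y <= b -> rect y z0.
Proof. by move=> yb; rewrite /rect /= subrr normr0 yb lexx; split => //; have := a_gt0; have := aa'; lra. Qed.

Let diff_p z : Q z -> exists l, cd Q p z l.
Proof.
move=> Qz; have [l hl] := diff_dpsi Qz; eexists; apply: cdM hl _.
exact: cdV psi_neq0 (psi_neq0 Qz) (cd_psi Qz).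
Qed.

(** The base point [z0] lies on the common top side of all the rectangles, so one [q0] is a
    primitive on each of them. *)
Let q0 := line_int p z0.

Let cd_q0 y z : 0 < y -> y <= b -> rect y z -> cd (rect y) q0 z (p z).
Proof.
move=> y0 yb yz.
apply: (cd_line_int (@convex_rect y) (@closed_rect y)) => //; last exact: rect_z0.
by move=> w /(rectQ y0) Qw; have [l hl] := diff_p Qw; exists l; apply: cd_sub (rectQ y0) hl.
Qed.

Let kappa := ln (cmod (psi z0)) - Re (q0 z0).
Let q z := q0 z + kappa%:C.

Let cd_q y z : 0 < y -> y <= b -> rect y z -> cd (rect y) q z (p z).
Proof.
by move=> y0 yb yz; rewrite -[p z]addr0; apply: cdD; [exact: cd_q0|exact: cd_cst].
Qed.

(* q is a holomorphic logarithm of psi, up to an imaginary constant *)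
Let Re_q z : Q z -> Re (q z) = ln (cmod (psi z)).
Proof.
move=> Qz; have [z1 /andP[z2 z3]] := Qz.
have Kz : rect (Im z) z by split; rewrite // lexx.
have K0 : rect (Im z) z0 by exact: rect_z0.
have sK : seg z0 z `<=` rect (Im z) by exact: convex_rect.
have E : psi z * cexp (- q0 z) = psi z0 * cexp (- q0 z0).
  apply: (@cd_eq_cst _ (fun z => psi z * cexp (- q0 z))) => w sw.
  have Kw := sK _ sw; have Qw := rectQ z2 Kw.
  have -> : 0 = dpsi w * cexp (- q0 w) + psi w * (cexp (- q0 w) * - p w).
    by rewrite /p; field; exact: psi_neq0.
  apply: cdM; first by apply: cd_sub (cd_psi Qw) => v /sK /(rectQ z2).
  by apply/cd_cexp_comp/cdN; apply: cd_sub sK (cd_q0 _ _ _).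
have Q0 : Q z0 by exact: rectQ K0.
have p1 := psi_gt1 Qz; have p2 := psi_gt1 Q0.
have := congr1 (fun z => ln (cmod z)) E.
rewrite (cmodM (psi z)) (cmodM (psi z0)) !cmod_cexp !lnM ?posrE ?expR_gt0 ?cmod_gt0 ?psi_neq0 //.
rewrite !expRK /q /kappa ReD /=.
have ReN w : Re (- w) = - Re w :> R by case: w.
by rewrite !ReN; lra.
Qed.

(** The top side is the same for every [tau], which is what makes the final bound uniform. *)
Let top_bound : exists2 B : R, 0 <= B & forall t : R, t0 - a <= t <= t0 + a ->
  cmod (q (t +i* b)) <= B.
Proof.
have [a0 a0' b0] := And3 a_gt0 aa' b_gt0.
have [B hB] : exists B : R, forall t : R, t0 - a <= t <= t0 + a -> cmod (q (t +i* b)) <= B.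
  apply: (@cousin _ (t0 - a) (t0 + a) (fun x y => exists B : R, forall t : R,
    x <= t <= y -> cmod (q (t +i* b)) <= B)); first by lra.
    move=> x y z _ _ [B hB] [B' hB']; exists (Num.max B B') => t /andP[xt tz].
    rewrite le_max; have [ty|ty] := leP t y; first by rewrite hB // xt.
    by rewrite orbC hB' // ltW.
  move=> t tI; have Kt x : t0 - a <= x <= t0 + a -> rect b (x +i* b).
    by move=> xI; split => /=; [rewrite ler_norml; lra|rewrite !lexx].
  have [d d0 hd] := cd_ct (cd_q b_gt0 (lexx b) (Kt t tI)) ltr01.
  exists d => // x y xa yb tx xt ty yt; exists (cmod (q (t +i* b)) + 1) => s /andP[xs sy].
  have := hd (s +i* b) (Kt s ltac:(lra)).
  have -> : s +i* b - t +i* b = (s - t)%:C by apply: complex_eqP => /=; ring.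
  rewrite cmod_real; have st : `|s - t| < d by rewrite ltr_norml; lra.
  move=> /(_ st) h; have := cmodD (q (t +i* b)) (q (s +i* b) - q (t +i* b)).
  by rewrite addrC subrK; lra.
exists B => //; apply: le_trans (hB t0 _); first exact: cmod_ge0.
by lra.
Qed.

(* Cauchy's theorem for q(z) cos(k (z - t0 - i tau)) on the boundary of the
   rectangle of height [tau, b]: the cosine makes the two vertical sides
   contribute with a sign. *)
Lemma rectangle_bound : exists B : R, forall tau, 0 < tau -> tau < b ->
  let u t := ln (cmod (psi (t +i* tau))) * cos (k * (t - t0)) in
  (forall t, t0 - a <= t <= t0 + a -> {for t, continuous u}) /\
  (\int[mu]_(t in `[(t0 - a)%R, (t0 + a)%R]) (u t)%:E <= B%:E)%E.
Proof.
have [a0 a0' b0] := And3 a_gt0 aa' b_gt0.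
have [B B0 hB] := top_bound.
have k0 : 0 < k by rewrite /k !divr_gt0 // pi_gt0.
have ka : k * a = pi / 2 by rewrite /k; field; lra.
(* The top side: [q] is bounded by [B], the cosine by [expR (k * b)], and the length is [2 * a]. *)
exists (B * expR (k * b) * (2 * a)) => tau tau0 taub u.
have taub' := ltW taub.
pose s : R[i] := t0 +i* tau.
pose c z := ccos (k%:C * (z - s)).
pose h z := q z * c z.
have diff_c z : exists l, cd (rect tau) c z l.
  have [l hl] := cd_ccos (k%:C * (z - s)).
  have h1 : cd (rect tau) (fun z => k%:C * (z - s)) z (k%:C * (1 - 0)).
    by apply/cdMl/cdB; [exact: cd_id|exact: cd_cst].
  by exists (l * (k%:C * (1 - 0))); exact: (cd_comp (E := setT) _ h1 hl).
have diff_h z : rect tau z -> exists l, cd (rect tau) h z l.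
  move=> Kz; have [l hl] := diff_c z; eexists; apply: cdM hl.
  exact: cd_q.
pose H := line_int h z0.
have dH z : rect tau z -> cd (rect tau) H z (h z).
  move=> Kz; apply: (cd_line_int (@convex_rect tau) (@closed_rect tau)) => //.
  exact: rect_z0.
have K x y : t0 - a <= x <= t0 + a -> tau <= y <= b -> rect tau (x +i* y).
  by move=> xI yI; split => //=; rewrite ler_norml; lra.
pose e0 : R[i] := (t0 - a) +i* tau. pose e1 : R[i] := (t0 + a) +i* tau.
pose e2 : R[i] := (t0 + a) +i* b. pose e3 : R[i] := (t0 - a) +i* b.
have K0 : rect tau e0 by apply: K; lra.
have K1 : rect tau e1 by apply: K; lra.
have K2 : rect tau e2 by apply: K; lra.
have K3 : rect tau e3 by apply: K; lra.
have sub x y : rect tau x -> rect tau y -> seg x y `<=` rect tau.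
  by move=> Kx Ky; exact: convex_rect.
have dHs x y z : rect tau x -> rect tau y -> seg x y z -> cd (seg x y) H z (h z).
  by move=> Kx Ky sz; apply: cd_sub (sub _ _ Kx Ky) (dH _ (sub _ _ Kx Ky _ sz)).
have Uge0 z : rect tau z -> 0 <= Re (q z).
  by move=> /(rectQ tau0) Qz; rewrite Re_q // ln_ge0 // ltW // psi_gt1.
have uE t : `|t - t0| <= a' -> Re (1 * (h (tau *i + t%:C * 1) * 1)) = u t.
  move=> tI; rewrite mul1r !mulr1; have -> : tau *i + t%:C = t +i* tau by simpc.
  rewrite /u /h /c -Re_q; last by split => //=; rewrite tau0 ltW.
  have -> : k%:C * (t +i* tau - s) = (k * (t - t0))%:C.
    by rewrite /s; apply: complex_eqP => /=; ring.
  by rewrite ccos_real; case: (q _) => x y; simpc.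
have sinh_ge0 y : tau <= y -> 0 <= (expR (k * (y - tau)) - expR (- (k * (y - tau)))) / 2.
  move=> y0; rewrite divr_ge0 // subr_ge0 ler_expR.
  have : 0 <= k * (y - tau) by rewrite mulr_ge0 ?subr_ge0 // ltW.
  lra.
(* Going up the right side, the cosine is [- i sinh] and [dz] is [i dy], so the integrand has real
   part [Re q * sinh >= 0]. *)
have right : 0 <= Re (1 * (H e2 - H e1)).
  have := @mean_value_re _ H h (-1) e1 e2 0 (fun z => @dHs _ _ z K1 K2).
  have -> : Re (-1 * (H e2 - H e1)) = - Re (1 * (H e2 - H e1)).
    by case: (H e2 - H e1) => x y; simpc.
  rewrite oppr_le0; apply => z sz; have Kz := sub _ _ K1 K2 _ sz.
  case: sz Kz => v v01; rewrite {1}/e1 {1}/e2.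
  have -> : (t0 + a) +i* tau + v%:C * ((t0 + a) +i* b - (t0 + a) +i* tau) =
    (t0 + a) +i* (tau + v * (b - tau)) by apply: complex_eqP => /=; ring.
  move=> -> Kz; rewrite /h /c.
  set y := tau + _; have ty : tau <= y by rewrite /y lerDl mulr_ge0 //; lra.
  have -> : k%:C * ((t0 + a) +i* y - s) = (pi / 2) +i* (k * (y - tau)).
    by rewrite /s -ka; apply: complex_eqP => /=; ring.
  rewrite ccos_pihalf; have := sinh_ge0 y ty; move: (_ / 2) => sh sh0.
  have -> : e2 - e1 = (b - tau) *i by rewrite /e2 /e1; apply: complex_eqP => /=; ring.
  have := Uge0 _ Kz; case: (q _) => x x' /= x0; simpc => /=.
  have : 0 <= x * sh * (b - tau) by rewrite !mulr_ge0 // subr_ge0.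
  lra.
(* Since the cosine is even, the hyperbolic sine appears here with the opposite sign. *)
have left : Re (1 * (H e3 - H e0)) <= 0.
  apply: (@mean_value_re _ H h 1 e0 e3 0 (fun z => @dHs _ _ z K0 K3)).
  move=> z sz; have Kz := sub _ _ K0 K3 _ sz.
  case: sz Kz => v v01; rewrite {1}/e0 {1}/e3.
  have -> : (t0 - a) +i* tau + v%:C * ((t0 - a) +i* b - (t0 - a) +i* tau) =
    (t0 - a) +i* (tau + v * (b - tau)) by apply: complex_eqP => /=; ring.
  move=> -> Kz; rewrite /h /c.
  set y := tau + _; have ty : tau <= y by rewrite /y lerDl mulr_ge0 //; lra.
  have -> : k%:C * ((t0 - a) +i* y - s) = - ((pi / 2) +i* (- (k * (y - tau)))).
    by rewrite /s -ka; apply: complex_eqP => /=; ring.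
  rewrite ccosN ccos_pihalf opprK; have := sinh_ge0 y ty.
  move: (expR (k * _)) (expR (- _)) => A A' sh0.
  have -> : (A' - A) / 2 = - ((A - A') / 2) by field.
  move: (_ / 2) sh0 => sh sh0.
  have -> : e3 - e0 = (b - tau) *i by rewrite /e3 /e0; apply: complex_eqP => /=; ring.
  have := Uge0 _ Kz; case: (q _) => x x' /= x0; simpc => /=.
  have : 0 <= x * sh * (b - tau) by rewrite !mulr_ge0 // subr_ge0.
  lra.
have top : Re (1 * (H e2 - H e3)) <= B * expR (k * b) * (2 * a).
  rewrite mul1r; apply: le_trans (ler_norm _) _; apply: le_trans (cmod_Re _) _.
  have -> : 2 * a = cmod (e2 - e3).
    have -> : e2 - e3 = (2 * a)%:C by rewrite /e2 /e3; apply: complex_eqP => /=; ring.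
    by rewrite cmod_real ger0_norm //; lra.
  apply: (mean_value (l := h) (fun z => @dHs _ _ z K3 K2)) => z [v /andP[v0 v1] ->].
  rewrite /e2 /e3.
  have -> : (t0 - a) +i* b + v%:C * ((t0 + a) +i* b - (t0 - a) +i* b) =
    (t0 - a + v * (2 * a)) +i* b.
    by apply: complex_eqP => /=; ring.
  set x := t0 - a + _; have xI : t0 - a <= x <= t0 + a by apply/andP; rewrite /x; split; nra.
  rewrite /h cmodM; apply: ler_pM; rewrite ?cmod_ge0 //; first exact: hB.
  apply: le_trans (cmod_ccos _) _; rewrite ler_expR /s; simpc => /=.
  rewrite ger0_norm; last by rewrite mulr_ge0 ?subr_ge0 // ltW.
  by rewrite ler_pM2l //; lra.
have bottom : (\int[mu]_(t in `[(t0 - a)%R, (t0 + a)%R]) (u t)%:E =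
    (Re (1 * H e1) - Re (1 * H e0))%:E)%E.
  have := @FTC2_line _ (rect tau) H h 1 (tau *i) 1 (t0 - a) (t0 + a).
  have -> : tau *i + (t0 + a)%:C * 1 = e1 by rewrite /e1; apply: complex_eqP => /=; ring.
  have -> : tau *i + (t0 - a)%:C * 1 = e0 by rewrite /e0; apply: complex_eqP => /=; ring.
  move=> <-; [|lra| |exact: dH|]; last first.
  - by move=> z Kz; have [l /cd_ct] := diff_h z Kz.
  - move=> t tI; exists (a' - a); first by rewrite subr_gt0.
    move=> x; rewrite ltr_norml => /andP[x1 x2].
    have -> : tau *i + x%:C * 1 = x +i* tau by apply: complex_eqP => /=; ring.
    by split => /=; [rewrite ler_norml; lra|rewrite lexx].
  apply: eq_integral => t; rewrite inE /= in_itv /= => tI; rewrite uE //.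
  by rewrite ler_norml; lra.
have near t x : t0 - a <= t <= t0 + a -> `|x - t| < a' - a -> `|x - t0| <= a'.
  by move=> tI; rewrite ltr_norml ler_norml => /andP[x1 x2]; lra.
split.
  move=> t tI; apply/real_contP => e e0'.
  have [|||d d0 hd] := (real_contP _ _).1 (@ct_re_continuous _ (rect tau) h 1
    (tau *i) 1 t (a' - a) _ _ _) e e0'.
  - by rewrite subr_gt0.
  - move=> x /(near t x tI) xt.
    have -> : tau *i + x%:C * 1 = x +i* tau by apply: complex_eqP => /=; ring.
    by split => //=; rewrite lexx.
  - have -> : tau *i + t%:C * 1 = t +i* tau by apply: complex_eqP => /=; ring.
    by have [|l /cd_ct] := diff_h (t +i* tau); first by apply: K; lra.
  exists (Num.min d (a' - a)); first by rewrite lt_min d0 subr_gt0.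
  move=> x; rewrite lt_min => /andP[/hd + /(near t x tI) xt].
  have tt : `|t - t0| <= a' by apply: (near t) => //; rewrite subrr normr0 subr_gt0.
  by have := uE x xt; have := uE t tt; rewrite !mulr1 => -> ->.
(* The bottom equals the top minus the right side plus the left side, both taken upwards. *)
rewrite bottom lee_fin; move: right left top; rewrite !mul1r !ReB; lra.
Qed.

End Rectangle.

(** * Transfer from the half-plane to the circle *)

Section ArcNull.
Variables (R : realType) (L dL : R[i] -> R[i]) (r : R).
Notation mu := (@lebesgue_measure R).
Hypothesis r_gt0 : 0 < r.
Hypothesis cd_L : forall z, cmod z < r -> cd setT L z (dL z).
Hypothesis diff_dL : forall z, cmod z < r -> exists l, cd setT dL z l.
Hypothesis blow_up_limit : forall a, cmod a = r ->
  (forall e : R, 0 < e -> exists b, [/\ cmod b = r, blow_up L r b & cmod (b - a) < e]) ->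
  blow_up L r a.

(** [P] maps the open upper half-plane into the disk and wraps the real axis around the circle. *)
Let P (z : R[i]) : R[i] := r%:C * cexp ('i * z).
Let T := [set t : R | blow_up L r (r%:C * cexp (t *i))].

Let PE (t : R) : P t%:C = r%:C * cexp (t *i).
Proof. by rewrite /P; congr (_ * cexp _); apply: complex_eqP; rewrite /=; ring. Qed.

Let cmodP z : cmod (P z) = r * expR (- Im z).
Proof. by rewrite cmodM cmod_real cmod_cexp muliE /= ger0_norm // ltW. Qed.

Let P_disk z : 0 < Im z -> cmod (P z) < r.
Proof.
by move=> z0; rewrite cmodP gtr_pMr // -expR0 ltr_expR oppr_lt0.
Qed.

Let P_circle (t : R) : cmod (P t%:C) = r.
Proof. by rewrite cmodP /= oppr0 expR0 mulr1. Qed.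

Let cd_P z : cd setT P z (r%:C * (cexp ('i * z) * ('i * 1))).
Proof. by apply/cdMl/cd_cexp_comp/cdMl; exact: cd_id. Qed.

Let closed_T : closed T.
Proof.
rewrite -[T]setCK; apply: open_closedC; rewrite openE => t nTt.
apply/nbhs_ballP; apply: contrapT => no; apply: nTt; rewrite /T /= -PE.
apply: blow_up_limit; first exact: P_circle.
move=> e e0; have [d d0 hd] := cd_ct (cd_P t%:C) e0.
apply: contrapT => no2; apply: no; exists d => // s; rewrite -ball_normE /= => ts Ts.
apply: no2; exists (P s%:C); split; [exact: P_circle|by rewrite PE|].
by apply: hd => //; rewrite -rmorphB cmod_real distrC.
Qed.

Let measurable_T : measurable T.
Proof. exact: closed_measurable. Qed.

(** Otherwise points above [T], at heights tending to 0 and with [L] bounded by [M], would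
    accumulate at a real point; it belongs to [T], as [T] is closed, which contradicts the blow-up
    there. *)
Let uniform_blow_up (x y b M : R) : 0 < b -> exists2 tau : R, 0 < tau < b &
  forall t, x <= t <= y -> T t -> M < cmod (L (P (t +i* tau))).
Proof.
move=> b0; apply: contrapT => no.
pose tau (n : nat) := b / 2 * n.+1%:R^-1.
have tau0 n : 0 < tau n by rewrite /tau mulr_gt0 ?invr_gt0 //; lra.
have taub n : tau n <= b / 2.
  by rewrite /tau ler_piMr ?invf_le1 ?ler1n //; lra.
have [u hu] : {u : nat -> R & forall n, [/\ x <= u n <= y, T (u n) &
    cmod (L (P (u n +i* tau n))) <= M]}.
  apply: (@choice _ _ (fun n t => [/\ x <= t <= y, T t &
    cmod (L (P (t +i* tau n))) <= M])) => n.
  apply: contrapT => no2; apply: no; exists (tau n).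
    by rewrite tau0 /=; have := taub n; lra.
  move=> t txy Tt; rewrite ltNge; apply/negP => h; apply: no2; by exists t.
pose v n : R[i] := u n +i* tau n.
have [l hl] : exists l, forall (e : R) N, 0 < e ->
    exists2 n, (N <= n)%N & cmod (v n - l) < e.
  apply: (@bolzano_weierstrassC _ v (`|x| + `|y| + b)) => n.
  apply: le_trans (cmod_leD _) _ => /=; apply: lerD.
    have [/andP[h1 h2] _ _] := hu n; rewrite ler_norml.
    have := ler_norm y; have := ler_norm (- x); rewrite normrN.
    have := normr_ge0 x; have := normr_ge0 y; lra.
  by rewrite gtr0_norm //; have := taub n; lra.
have tau_small (e : R) : 0 < e -> exists N, forall n, (N <= n)%N -> tau n < e.
  move=> e0; have [|N hN] := @inv_small R (e / b); first by rewrite divr_gt0.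
  exists N => n Nn; have := inv_small_le hN Nn; rewrite ltr_pdivlMr // /tau.
  have : 0 < n.+1%:R^-1 * b by rewrite mulr_gt0 // invr_gt0.
  move: (_^-1) => w; lra.
have near (e : R) : 0 < e -> exists n,
    [/\ cmod (v n - (Re l)%:C) < e & cmod ((u n)%:C - (Re l)%:C) < e].
  move=> e0; have e2 : 0 < e / 2 by lra.
  have [N hN] := tau_small _ e2; have [n Nn hn] := hl _ N e2; exists n.
  have h1 := le_lt_trans (cmod_Re _) hn; rewrite ReB /= in h1.
  have h2 := hN n Nn; have h3 := tau0 n; split.
    apply: le_lt_trans (cmod_leD _) _; rewrite ReB ImB /= subr0 (gtr0_norm h3); lra.
  by rewrite -rmorphB cmod_real; lra.
have bl : blow_up L r (P (Re l)%:C).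
  apply: blow_up_limit; first exact: P_circle.
  move=> e e0; have [d d0 hd] := cd_ct (cd_P (Re l)%:C) e0.
  have [n [_ hn]] := near d d0; exists (P (u n)%:C); split.
  - exact: P_circle.
  - by rewrite PE; have [] := hu n.
  - exact: hd.
have [d d0 hd] := bl M.
have [d' d'0 hd'] := cd_ct (cd_P (Re l)%:C) d0.
have [n [hn _]] := near d' d'0; have [_ _] := hu n.
rewrite leNgt => /negP; apply; apply: hd; last exact: hd'.
by apply: P_disk; exact: tau0.
Qed.

(** [cos (2 * x) >= 0] gives [cos x ^+ 2 >= 1 / 2], of which the cruder bound is kept. *)
Let cos_ge_half (x : R) : - (pi / 4) <= x <= pi / 4 -> 1 / 2 <= cos x.
Proof.
move=> xI; have p0 := pi_gt0 R.
have c0 : 0 < cos x by apply: cos_gt0_pihalf; lra.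
have h : 0 <= cos (2 * x) by apply: cos_ge0_pihalf; lra.
rewrite mulr_natl cos_mulr2n -mulr_natl in h.
rewrite leNgt; apply/negP => h'.
have h3 : cos x ^+ 2 < 1 / 4 by rewrite expr2; nra.
move: h h3; set y := cos x ^+ 2; lra.
Qed.

Let local_null (t0 : R) : T t0 -> exists2 d : R, 0 < d &
  mu (T `&` `[t0 - d, t0 + d]) = 0.
Proof.
move=> Tt0; rewrite /T /= -PE in Tt0.
have [e e0 he] := Tt0 1.
have [rho rho0 hrho] := cd_ct (cd_P t0%:C) e0.
(* [a' + b < rho] keeps the rectangle where [cmod (L (P z)) > 1], so that its logarithm is
   positive. *)
pose a := rho / 4; pose a' := rho / 2; pose b := rho / 4.
pose psi z := L (P z).
pose dpsi z := dL (P z) * (r%:C * (cexp ('i * z) * ('i * 1))).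
pose Q : set R[i] := [set z | `|Re z - t0| <= a' /\ 0 < Im z <= b].
have a0 : 0 < a by rewrite /a; lra.
have aa' : a < a' by rewrite /a /a'; lra.
have b0 : 0 < b by rewrite /b; lra.
have Qr z : Q z -> cmod (P z) < r by move=> [_ /andP[z0 _]]; exact: P_disk.
have cd_psi z : Q z -> cd Q psi z (dpsi z).
  move=> Qz; apply: (cd_comp (E := setT)) => //; last by apply: cd_L; exact: Qr.
  exact: cd_sub (cd_P z).
have diff_dpsi z : Q z -> exists l, cd Q dpsi z l.
  move=> Qz; have [l hl] := diff_dL (Qr z Qz).
  have cP : cd Q P z (r%:C * (cexp ('i * z) * ('i * 1))) by exact: cd_sub (cd_P z).
  eexists; apply: cdM; first exact: (cd_comp (E := setT) _ cP hl).
  apply: cdMl; apply: cdM (cd_cst _ _ _).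
  by apply/cd_cexp_comp/cdMl; exact: cd_id.
have psi1 z : Q z -> 1 < cmod (psi z).
  move=> Qz; have [z1 /andP[z2 z3]] := Qz; apply: he; first exact: Qr.
  apply: hrho => //; apply: le_lt_trans (cmod_leD _) _.
  rewrite ReB ImB /= subr0 (gtr0_norm z2).
  by rewrite /a' in z1; rewrite /b in z3; lra.
have [B hB] := rectangle_bound a0 aa' b0 cd_psi diff_dpsi psi1.
set k := pi / 2 / a in hB.
have ka : k * a = pi / 2 by rewrite /k; field; lra.
have p0 := pi_gt0 R.
have k0 : 0 < k by rewrite /k !divr_gt0.
(* On the half-size interval the cosine weight is at least [1 / 2]. *)
exists (a / 2); first by lra.
apply: (@null_of_bounded_integrals _ (t0 - a) (t0 + a) B).
- apply: measurableI => //; exact: measurable_itv.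
- by move=> t [_]; rewrite /= !in_itv /=; lra.
move=> N N0.
(* The factor 2 in the exponent makes up for the weight [1 / 2]. *)
have [tau /andP[tau0 taub] htau] := uniform_blow_up (t0 - a) (t0 + a) (expR (2 * N)) b0.
have [h1 h2] := hB tau tau0 taub.
exists (fun t => ln (cmod (psi (t +i* tau))) * cos (k * (t - t0))); split => //.
- move=> t tI; have Qt : Q (t +i* tau).
    by split => /=; [rewrite ler_norml; lra|rewrite tau0 ltW].
  apply: mulr_ge0; first by rewrite ln_ge0 // ltW // psi1.
  apply: cos_ge0_pihalf; rewrite -ka.
  have -> : - (k * a) = k * - a by ring.
  by rewrite !ler_pM2l //; lra.
- move=> t [Tt]; rewrite /= in_itv /= => tI.
  have c2 : 1 / 2 <= cos (k * (t - t0)).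
    apply: cos_ge_half; have -> : pi / 4 = k * (a / 2) by rewrite mulrA ka; field.
    have -> : - (k * (a / 2)) = k * - (a / 2) by ring.
    by rewrite !ler_pM2l //; lra.
  have l2 : 2 * N <= ln (cmod (psi (t +i* tau))).
    rewrite -[2 * N]expRK ler_ln ?posrE ?expR_gt0 //; last first.
      by apply: lt_trans (htau t _ Tt); [exact: expR_gt0|lra].
    by apply/ltW/htau => //; lra.
  nra.
Qed.

(** Cousin's lemma glues null intervals: around points of [T] they come from [local_null], and
    around other points small intervals miss the closed set [T]. *)
Lemma arc_null : mu (`[0, 2 * pi[ `&` T) = 0.
Proof.
have p0 := pi_gt0 R.
have mI x y : measurable (T `&` `[x, y]).
  by apply: measurableI => //; exact: measurable_itv.
have null0 x y x' y' : x' <= x -> y <= y' -> mu (T `&` `[x', y']) = 0 ->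
    mu (T `&` `[x, y]) = 0.
  move=> xx yy; apply: subset_measure0; [exact: mI|exact: mI|].
  by move=> t [Tt]; rewrite /= !in_itv /= => tI; split => //=; lra.
have H : mu (T `&` `[0, 2 * pi]) = 0.
  apply: (@cousin _ 0 (2 * pi) (fun x y => mu (T `&` `[x, y]) = 0)); first by lra.
    move=> x y z xy yz h1 h2.
    have sub : T `&` `[x, z] `<=` (T `&` `[x, y]) `|` (T `&` `[y, z]).
      move=> t [Tt]; rewrite /= !in_itv /= => /andP[xt tz].
      by have [ty|ty] := leP t y; [left|right]; split => //=; lra.
    apply: (@subset_measure0 _ _ _ mu _ ((T `&` `[x, y]) `|` (T `&` `[y, z])));
      [exact: mI|exact: measurableU (mI _ _) (mI _ _)|exact: sub|].
    have e := @measureU0 _ _ _ mu _ _ (mI x y) (mI y z) h2.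
    exact: (etrans e h1).
  move=> t _; have [/local_null[d d0 hd]|nT] := pselect (T t).
    by exists d => // x y _ _ h1 h2 h3 h4; apply: null0 hd; lra.
  have : \forall s \near t, ~ T s.
    by have := closed_openC closed_T; rewrite openE; apply.
  move=> /nbhs_ballP[d /= d0 hd]; exists d => // x y _ _ h1 h2 h3 h4.
  rewrite (_ : T `&` `[x, y] = set0) ?measure0 //.
  apply/seteqP; split => // s [Ts]; rewrite /= in_itv /= => sI.
  by apply: (hd s) => //; rewrite -ball_normE /= ltr_norml; lra.
apply: subset_measure0 H; [by apply: measurableI => //; exact: measurable_itv|exact: mI|].
by move=> t [+ Tt]; rewrite /= !in_itv /= => tI; split => //=; lra.
Qed.

End ArcNull.

(** * Asymptotic values *)

Section Infinity.
Variable R : realType.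

(** In [R[i]] the neighbourhoods of [+oo] are indexed by elements [M] of [R[i]] that are real, hence
    the passage through [Re M]. *)
Lemma cvg_infinityCP T (F : set_system T) (FF : Filter F) (f : T -> R[i]) :
  (forall M : R, \forall x \near F, M < cmod (f x)) -> `|f x| @[x --> F] --> +oo.
Proof.
move=> H A [M [Mr hA]]; apply: (filterS _ (H (Re M))) => x Mx; apply: hA.
by rewrite /= cmodE -(RRe_real Mr) ltcR.
Qed.

Lemma circle0P (z : R[i]) (r : R) : circle 0 r z <-> cmod z = r.
Proof. by rewrite /circle /= subr0 cmodE; split => [[]|->]. Qed.

Lemma bounded_setCP (A : set R[i]) : bounded_set A ->
  exists M : R, forall z, A z -> cmod z <= M.
Proof.
case=> M [Mr hM]; exists (Re M + 1) => z Az.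
have := hM (Re M + 1)%:C; rewrite -{1}(RRe_real Mr) ltcR ltrDl ltr01.
by move=> /(_ isT z Az) /=; rewrite cmodE lecR.
Qed.

End Infinity.

Section Asymptotic.
Variables (R : realType) (f g L : R[i] -> R[i]) (r : R).
Hypothesis r_gt0 : 0 < r.
Hypothesis ct_f : forall z, ct setT f z.
Hypothesis ct_L : forall z, cmod z < r -> ct setT L z.
Hypothesis gL : forall z, cmod z < r -> g (L z) = f z.

(* The curve is the image under L of the radius ending at a. *)
Lemma blow_up_asymptotic a : cmod a = r -> blow_up L r a -> asymptotic_values g (f a).
Proof.
(* [t / (1 + t)] maps the half-line into [[0, 1[] and is 1-Lipschitz there; the distance from [c t]
   to [a] is [r / (1 + t)]. *)
move=> ar bl; pose s (t : R) := t / (1 + t); pose c (t : R) := (s t)%:C * a.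
have s01 t : 0 <= t -> 0 <= s t < 1.
  move=> t0; rewrite /s divr_ge0 ?addr_ge0 //= ltr_pdivrMr ?mul1r; lra.
have cr t : 0 <= t -> cmod (c t) < r.
  move=> /s01 /andP[h1 h2]; rewrite cmodM cmod_real ger0_norm // ar.
  by rewrite gtr_pMl.
have ca (d : R) : 0 < d -> \forall t \near +oo, 0 <= t /\ cmod (c t - a) < d.
  move=> d0; exists (r / d); split; first exact: num_real.
  move=> t; rewrite ltr_pdivrMr // => rt.
  have t0 : 0 < t by rewrite -(pmulr_lgt0 _ d0); exact: lt_trans rt.
  split; first exact: ltW.
  have -> : c t - a = (- (1 + t)^-1)%:C * a.
    rewrite /c /s -[X in _ - X]mul1r -mulrBl -(rmorph1 (real_complex R)) -rmorphB.
    by congr (_%:C * _); field; lra.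
  rewrite cmodM cmod_real normrN ger0_norm ?invr_ge0 ?ar; last lra.
  rewrite mulrC ltr_pdivrMr; lra.
exists (fun t => L (c t)); split.
- apply/subspace_continuousP => t; rewrite /= in_itv /= andbT => t0.
  apply/cvgCP => e e0; have [d d0 hd] := ct_L (cr t t0) e0.
  rewrite near_withinE; apply/nbhs_ballP; exists (d / r) => /=; first by rewrite divr_gt0.
  move=> y; rewrite /ball /= ltr_pdivlMr // in_itv /= andbT => ty y0; apply: hd => //.
  have -> : c y - c t = (s y - s t)%:C * a by rewrite /c rmorphB; ring.
  rewrite cmodM cmod_real ar; apply: le_lt_trans ty; rewrite ler_wpM2r ?(ltW r_gt0) //.
  have -> : s y - s t = (y - t) / ((1 + y) * (1 + t)) by rewrite /s; field; lra.
  have p1 : 1 <= (1 + y) * (1 + t) by nra.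
  rewrite normrM normrV ?unitfE; last by rewrite gt_eqF //; lra.
  rewrite (ger0_norm (x := _ * _)); last by lra.
  by rewrite distrC ler_piMr // invf_le1 //; lra.
- apply: cvg_infinityCP => M; have [d d0 hd] := bl M.
  by apply: filterS (ca d d0) => t [t0 ta]; apply: hd => //; exact: cr.
- apply/cvgCP => e e0; have [d d0 hd] := ct_f a e0.
  by apply: filterS (ca d d0) => t [t0 ta]; rewrite gL; [exact: hd|exact: cr].
Qed.

End Asymptotic.

(** * Assembly of the theorem *)

Theorem theorem7p1 (R : realType) (F G L : R[i] -> R[i]) (r : R)
    (entire_F : entire F) (nonconstant_F : nonconstant F)
    (entire_G : entire G) (nonconstant_G : nonconstant G)
    (r_gt0 : 0 < r)
    (holomorphic_L : holomorphic_on (disk 0 r) L)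
    (ode_L : forall z, disk 0 r z ->
      derive1 L z = cexp (F z) * cexp (- G (L z)))
    (L0 : L 0 = 0)
    (maximal_L : forall e : R, 0 < e ->
      ~ continues_to (disk 0 r) L (disk 0 (r + e))) :
  let f := primitive0 (fun t => cexp (F t)) in
  let g := primitive0 (fun t => cexp (G t)) in
  (~ exists (z_ : nat -> R[i]) (alpha : R[i]),
      [/\ forall n, disk 0 r (z_ n),
          closed_disk 0 r alpha,
          z_ n @[n --> \oo] --> alpha,
          bounded_set (range (fun n => L (z_ n)))
        & ~ exists l : R[i], L (z_ n) @[n --> \oo] --> l]) /\
  exists A : set R[i],
    A `<=` circle 0 r /\
    (forall alpha, (circle 0 r `\` A) alpha ->
      exists l : R[i], L z @[z --> within (disk 0 r) (nbhs alpha)] --> l) /\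
    (forall alpha, (circle 0 r `\` A) alpha ->
      exists2 e : R, 0 < e & continues_to (disk 0 r) L (disk alpha e)) /\
    [/\ A !=set0,
        forall alpha, A alpha ->
          `|L z| @[z --> within (disk 0 r) (nbhs alpha)] --> +oo /\
          g (L z) @[z --> within (disk 0 r) (nbhs alpha)] --> f alpha,
        f @` A `<=` asymptotic_values g,
        closed A
      & arc_length r A = 0%E].
Proof.
move=> f g.
have cd_F z : cd setT F z (derive1 F z) by apply: derivable_cd; exact: entire_F.
have cd_G z : cd setT G z (derive1 G z) by apply: derivable_cd; exact: entire_G.
have cd_f z : cd setT f z (cexp (F z)).
  by apply: cd_primitive0 => w; eexists; apply: cd_cexp_comp; exact: cd_F.
have cd_eG w : cd setT (fun z => cexp (G z)) w (cexp (G w) * derive1 G w).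
  by apply: cd_cexp_comp; exact: cd_G.
have cd_g z : cd setT g z (cexp (G z)).
  by apply: cd_primitive0 => w; eexists; exact: cd_eG.
have ct_dg w : ct setT (fun z => cexp (G z)) w := cd_ct (cd_eG w).
have dg0 w : cexp (G w) != 0 by exact: cexp_neq0.
pose dL z := cexp (F z) * cexp (- G (L z)).
have cd_L z : cmod z < r -> cd setT L z (dL z).
  by move=> /disk0P zr; rewrite /dL -ode_L //; apply: derivable_cd; exact: holomorphic_L.
have diff_L z : cmod z < r -> exists l, cd setT L z l by move=> /cd_L; exists (dL z).
have diff_f z : exists l, cd setT f z l by exists (cexp (F z)).
(* The right-hand side of the equation is built from [F], [G] and [L], so [L'] is differentiable by
   the chain rule; the logarithm of [L] in the measure estimate relies on this. *)
have diff_dL z : cmod z < r -> exists l, cd setT dL z l.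
  move=> zr; eexists; apply: cdM; first by apply: cd_cexp_comp; exact: cd_F.
  apply/cd_cexp_comp/cdN; exact: (cd_comp (E := setT) _ (cd_L z zr) (cd_G (L z))).
have ct_f z : ct setT f z := cd_ct (cd_f z).
have gL z : cmod z < r -> g (L z) = f z.
  move=> zr; apply/eqP; rewrite -subr_eq0; apply/eqP.
  have -> : 0 = g (L 0) - f 0 by rewrite L0 /f /g !primitive00 subrr.
  apply: (@cd_eq_cst _ (fun z => g (L z) - f z)) => w sw.
  have wr : cmod w < r.
    by have := cmod_seg sw; rewrite !subr0 => /le_lt_trans; apply.
  have -> : 0 = cexp (G (L w)) * dL w - cexp (F w).
    by rewrite /dL cexpN; field; exact: dg0.
  apply: (cd_sub (E := setT)) => //; apply: cdB => //.
  exact: (cd_comp (E := setT) _ (cd_L w wr) (cd_g (L w))).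
split.
  move=> [u [al [ur _ ual bu nl]]]; apply: nl.
  have [M hM] := bounded_setCP bu.
  have [|n|d d0|l hl] := @bounded_seq_cvg _ f g _ L r cd_g ct_dg dg0 diff_f diff_L gL al u M.
  - by move=> n; apply/disk0P; exact: ur.
  - by apply: hM; exists n.
  - by move/cvg_seqCP : ual => /(_ d d0).
  by exists l; apply/cvg_seqCP.
have dich := blow_up_or_limit cd_g ct_dg dg0 diff_f diff_L gL.
have blc a := blow_up_closed cd_g ct_dg dg0 diff_f diff_L gL (a := a) r_gt0.
pose A := [set a | circle 0 r a /\ blow_up L r a].
have NA a : (circle 0 r `\` A) a -> exists w, cluster_value L r a w /\ limit_value L r a w.
  by move=> [ca nA]; have [ba|//] := dich a; exfalso; apply: nA.
exists A; split; [by move=> a []|split; [|split; [|split]]].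
- move=> a /NA[w [_ lw]]; exists w; apply/cvg_withinCP => e /lw[d d0 hd].
  by exists d => // z /disk0P zr; exact: hd.
- move=> a /NA[w [cw _]].
  have [e [h [e0 hext]]] := cluster_extension cd_g ct_dg dg0 diff_f diff_L gL cw.
  exists e => //; exists h.
    move=> z /diskP za; have [l hl] := extension_cd cd_g dg0 diff_f hext za.
    by have [] := cd_derivable hl.
  by move=> z /disk0P zr /diskP za; have [_ _ ->] := hext.
- apply: contrapT => /nonemptyPn A0.
  have [|e e0 [H dH HL]] := global_extension cd_g ct_dg dg0 diff_f diff_L r_gt0.
    move=> a ar; have [|w [cw _]] := NA a.
      by split; [exact/circle0P|rewrite A0].
    exact: (cluster_extension cd_g ct_dg dg0 diff_f diff_L gL cw).
  apply: (maximal_L e e0); exists H.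
    by move=> z /disk0P zr; have [l hl] := dH z zr; have [] := cd_derivable hl.
  by move=> z /disk0P zr _; exact: HL.
- move=> a [_ ba]; split.
    apply: cvg_infinityCP => M; apply/near_withinC; have [d d0 hd] := ba M.
    by exists d => // z /disk0P zr; exact: hd.
  apply/cvg_withinCP => e e0; have [d d0 hd] := ct_f a e e0.
  by exists d => // z /disk0P zr za; rewrite gL //; exact: hd.
- move=> _ [a [/circle0P ca ba] <-].
  by apply: (blow_up_asymptotic r_gt0 ct_f _ gL ca ba) => z /diff_L[l /cd_ct].
- rewrite -[A]setCK; apply: open_closedC; rewrite openE => a nAa.
  apply/near_nbhsC; apply: contrapT => no; apply: nAa.
  have H (e : R) : 0 < e -> exists b, [/\ cmod b = r, blow_up L r b & cmod (b - a) < e].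
    move=> e0; apply: contrapT => no2; apply: no; exists e => // b ba [/circle0P cb bb].
    by apply: no2; exists b.
  have ar : cmod a = r.
    apply/eqP; rewrite -subr_eq0 -normr_eq0 eq_le normr_ge0 andbT.
    apply/ler_addgt0Pr => e e0; have [b [br _ ba]] := H e e0; rewrite add0r.
    have := cmodD a (b - a); have := cmodD b (a - b).
    rewrite ![_ + (_ - _)]addrC !subrK br [cmod (a - _)]cmodB => h1 h2.
    by rewrite ler_norml; lra.
  by split; [exact/circle0P|exact: blc].
- rewrite /arc_length (_ : [set t : R | A (r%:C * cexp (t *i))] =
    [set t : R | blow_up L r (r%:C * cexp (t *i))]).
    by rewrite (arc_null r_gt0 cd_L diff_dL blc) mule0.
  apply/seteqP; split => t /=; first by move=> [].
  split => //; apply/circle0P; rewrite cmodM cmod_real cmod_cexp /= expR0 mulr1.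
  by rewrite ger0_norm // ltW.
Qed.
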